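(* Let $f:\mathbb{A}\to\mathbb{A}$ be a negative-torsion map of the annulus $\mathbb{A}=\mathbb{T}\times\mathbb{R}$. Then $$\dim_H\big(\{z\in\mathbb{A}:\ \mathrm{Torsion}(f,z)=0\}\big)\ge 1,$$ where $\dim_H(\cdot)$ denotes the Hausdorff dimension and the set consists of the points $z$ at which the torsion of $f$ exists and equals $0$.
   Context: $\mathbb{T}=\mathbb{R}/\mathbb{Z}$, $\mathbb{A}=\mathbb{T}\times\mathbb{R}$ with the standard Riemannian metric and the standard trivialization of its tangent bundle ($T_x\mathbb{A}\cong\mathbb{R}^2$), with the counterclockwise orientation. $\chi=(0,1)$ is the unit positive vertical vector. For non-zero vectors $u,v\in\mathbb{R}^2$, $\theta(u,v)\in\mathbb{T}$ is the oriented angle from $u$ to $v$, measured in turns (a full counterclockwise turn is $1$). An isotopy is an arc in $\mathrm{Diff}^1(\mathbb{A})$ continuous for the compact-open (weak) $\mathcal{C}^1$ topology. Let $f:\mathbb{A}\to\mathbb{A}$ be a $\mathcal{C}^1$ diffeomorphism isotopic to the identity, and $(f_t)_{t\in[0,1]}$ an isotopy with $f_0=\mathrm{Id}$, $f_1=f$; extend it to $t\in\mathbb{R}_+=[0,+\infty)$ by $f_t=f_{t-\lfloor t\rfloor}\circ f^{\lfloor t\rfloor}$, and write $I=(f_t)_{t\ge0}$. For $x\in\mathbb{A}$ and $\xi\in T_x\mathbb{A}\setminus\{0\}$ let $\tilde v(I,x,\xi):\mathbb{R}_+\to\mathbb{R}$ be a continuous lift of $t\mapsto\theta(\chi,Df_t(x)\xi)\in\mathbb{T}$.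 For an integer $n\ge1$, $$\mathrm{Torsion}_n(f,x,\xi)=\frac{\tilde v(I,x,\xi)(n)-\tilde v(I,x,\xi)(0)}{n}.$$ This does not depend on the lift nor on the chosen isotopy. The torsion at $x$ is $\mathrm{Torsion}(f,x)=\lim_{n\to+\infty}\mathrm{Torsion}_n(f,x,\xi)$ whenever the limit exists; it does not depend on $\xi\neq0$. A negative-torsion map is a $\mathcal{C}^1$ diffeomorphism $f:\mathbb{A}\to\mathbb{A}$ isotopic to the identity such that $\mathrm{Torsion}_1(f,z,\chi)<0$ for every $z\in\mathbb{A}$. *)

(* Defs.v *)
From HB Require Import structures.
From mathcomp Require Import all_boot all_order all_algebra.
From mathcomp Require Import generic_quotient ring_quotient.
From mathcomp Require Import all_classical all_reals all_analysis.

Set Implicit Arguments.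
Unset Strict Implicit.
Unset Printing Implicit Defensive.

Import Order.TTheory GRing.Theory Num.Theory.
Import numFieldNormedType.Exports.

Local Open Scope classical_set_scope.
Local Open Scope ring_scope.

Definition integers (R : realType) : zmodClosed R :=
  GRing.ZmodClosed.clone R (@Num.int_num_subdef R) _.

Definition circle (R : realType) : Type :=
  quotient_topology (Quotient.quot (integers R)).

HB.instance Definition _ (R : realType) := Topological.on (circle R).
(* The group law of the quotient; it is not obtained by GRing.Zmodule.copy, so
   that it shares its choiceType with the topological structure. *)
HB.instance Definition _ (R : realType) :=
  let Q := Quotient.quot (integers R) in
  GRing.isZmodule.Build (circle R) (@addrA Q) (@addrC Q) (@add0r Q) (@addNr Q).

Definition circle_pi (R : realType) (a : R) : circle R :=
  (\pi_(Quotient.quot (integers R)) a)%qT.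

Definition annulus (R : realType) : Type := (circle R * R)%type.

(* The universal covering R^2 -> A; it is a group morphism and a local isometry.
   Translation, h |-> x + cover h, is the exponential map at x, and it
   identifies T_x A with R^2 in the standard trivialization. *)
Definition cover (R : realType) (h : 'cV[R]_2) : annulus R :=
  (circle_pi (h 0 0), h 1 0).

Definition enorm (R : realType) (h : 'cV[R]_2) : R :=
  Num.sqrt (h 0 0 ^+ 2 + h 1 0 ^+ 2).

(* The Riemannian distance: the geodesics of A are the images under [cover] of
   straight segments of R^2. *)
Definition annulus_dist (R : realType) (x y : annulus R) : R :=
  inf [set enorm h | h in [set h | y = x + cover h]].

(* [L] is the differential of [f] at [x]: [F] is [f] read in the charts
   h |-> x + cover h and k |-> f x + cover k.  [F 0] need not be 0, but it is
   necessarily a deck translation. *)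
Definition is_differential (R : realType) (f : annulus R -> annulus R)
    (x : annulus R) (L : 'M[R]_2) : Prop :=
  exists2 F : 'cV[R]_2 -> 'cV[R]_2,
    (\forall h \near (0 : 'cV[R]_2), f (x + cover h) = f x + cover (F h)) &
    is_diff (0 : 'cV[R]_2) F (mulmx L).

Definition differential (R : realType) (f : annulus R -> annulus R)
    (x : annulus R) : 'M[R]_2 :=
  xget 0 [set L | is_differential f x L].

Definition C1_map (R : realType) (f : annulus R -> annulus R) : Prop :=
  (forall x, is_differential f x (differential f x)) /\ continuous (differential f).

Definition C1_diffeo (R : realType) (f : annulus R -> annulus R) : Prop :=
  C1_map f /\
  exists g : annulus R -> annulus R, [/\ cancel f g, cancel g f & C1_map g].

(* In the standard trivialization of TA, the weak C^1 topology is the initial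
   topology of f |-> (f, differential f) for the compact-open topologies. *)
Definition isotopy (R : realType) (f : annulus R -> annulus R)
    (I : R -> annulus R -> annulus R) : Prop :=
  [/\ forall t, t \in `[0, 1] -> C1_diffeo (I t),
      {within `[0, 1], continuous
        (I : R -> {compact-open, annulus R -> annulus R})},
      {within `[0, 1], continuous
        ((fun t => differential (I t)) : R -> {compact-open, annulus R -> 'M[R]_2})},
      I 0 = id & I 1 = f].

Definition isotopic_to_id (R : realType) (f : annulus R -> annulus R) : Prop :=
  exists I, isotopy f I.

(* f_t = f_{t - floor t} o f^{floor t}, meant for t >= 0. *)
Definition extend_isotopy (R : realType) (f : annulus R -> annulus R)
    (I : R -> annulus R -> annulus R) (t : R) : annulus R -> annulus R :=
  I (t - (Num.truncn t)%:R) \o iter (Num.truncn t) f.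

Definition chi (R : realType) : 'cV[R]_2 :=
  \col_(i < 2) (if i == 0 then 0 else 1).

(* Counterclockwise, by [a] full turns. *)
Definition rotation (R : realType) (a : R) : 'M[R]_2 :=
  \matrix_(i < 2, j < 2)
    if i == j then cos (2 * pi * a)
    else if i == 0 then - sin (2 * pi * a) else sin (2 * pi * a).

(* For non-zero [u] and [v], the numbers [a] below form a class modulo Z. *)
Definition angle (R : realType) (u v : 'cV[R]_2) : circle R :=
  circle_pi
    (xget 0 [set a | enorm u *: v = enorm v *: (rotation a *m u)]).

Definition angle_lift (R : realType) (f : annulus R -> annulus R)
    (I : R -> annulus R -> annulus R) (x : annulus R) (xi : 'cV[R]_2)
    (v : R -> R) : Prop :=
  {within `[0, +oo[, continuous v} /\
  forall t, 0 <= t ->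
    circle_pi (v t) = angle (chi R) (differential (extend_isotopy f I t) x *m xi).

(* The torsion depends neither on the isotopy nor on the lift: both are chosen
   once and for all, the isotopy as a function of [f] only. *)
Definition chosen_isotopy (R : realType) (f : annulus R -> annulus R) :
    R -> annulus R -> annulus R :=
  xget ((fun=> id) : R -> annulus R -> annulus R) [set I | isotopy f I].

Definition chosen_lift (R : realType) (f : annulus R -> annulus R)
    (x : annulus R) (xi : 'cV[R]_2) : R -> R :=
  xget ((fun=> 0) : R -> R) [set v | angle_lift f (chosen_isotopy f) x xi v].

Definition torsion_n (R : realType) (n : nat) (f : annulus R -> annulus R)
    (x : annulus R) (xi : 'cV[R]_2) : R :=
  (chosen_lift f x xi n%:R - chosen_lift f x xi 0) / n%:R.

(* Existence of the limit is part of the statement. *)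
Definition has_torsion (R : realType) (f : annulus R -> annulus R)
    (x : annulus R) (tau : R) : Prop :=
  forall xi : 'cV[R]_2, xi != 0 ->
    (fun n => torsion_n n f x xi) @ \oo --> tau.

Definition negative_torsion_map (R : realType)
    (f : annulus R -> annulus R) : Prop :=
  [/\ C1_diffeo f, isotopic_to_id f &
      forall z, torsion_n 1 f z (chi R) < 0].

Local Open Scope ereal_scope.

Definition diam (R : realType) (T : Type) (d : T -> T -> R) (U : set T) :
    \bar R :=
  ereal_sup ([set 0] `|` [set (d x y)%:E | x in U & y in U]).

(* Since 0 `^ 0 = 1, the empty set needs a separate treatment when s = 0. *)
Definition diam_pow (R : realType) (T : Type) (d : T -> T -> R) (s : R)
    (U : set T) : \bar R :=
  if U == set0 then 0 else diam d U `^ s.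

Definition hausdorff_content (R : realType) (T : Type) (d : T -> T -> R)
    (s delta : R) (E : set T) : \bar R :=
  ereal_inf [set \sum_(0 <= k <oo) diam_pow d s (U k) |
    U in [set U : nat -> set T |
      E `<=` \bigcup_k U k /\ forall k, diam d (U k) <= delta%:E]].

Definition hausdorff_measure (R : realType) (T : Type) (d : T -> T -> R)
    (s : R) (E : set T) : \bar R :=
  ereal_sup [set hausdorff_content d s delta E |
    delta in [set delta : R | (0 < delta)%R]].

Definition hausdorff_dim (R : realType) (T : Type) (d : T -> T -> R)
    (E : set T) : \bar R :=
  ereal_inf [set s%:E | s in
    [set s : R | (0 <= s)%R /\ hausdorff_measure d s E = 0]].

(* Main.v *)
Require Import Defs.
From mathcomp Require Import all_boot all_order all_algebra.
From mathcomp Require Import generic_quotient ring_quotient.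
From mathcomp Require Import all_classical all_reals all_analysis.
From mathcomp Require Import ring lra.

(* Every horizontal circle contains a point of zero torsion; as the height is
   1-Lipschitz, the dimension is at least 1.  Let the tangent vector (1, 0) of
   the circle, at angle -1/4, follow the isotopy.  Vertical vectors turn
   clockwise and two vectors moved by linear isomorphisms cannot cross, so an
   angle that is at most j/2, with j an integer, remains so.  At time n, all the
   chords issued from a lowest point of the lifted image curve point upwards,
   while the chord from a point to its translate by the deck transformation
   keeps the angle -1/4: hence the tangent vector at the lowest point has a
   lifted angle at least -1/4, which must have been greater than -1/2 at all
   earlier times.  By compactness, the angle stays in [-1/2, 0] forever for some
   point of the circle, whose torsion is therefore 0. *)

Set Implicit Arguments.
Unset Strict Implicit.
Unset Printing Implicit Defensive.

Import Order.TTheory GRing.Theory Num.Theory.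
Import numFieldNormedType.Exports.
(* [cover] is also the name of a notion of classical_sets. *)
Import Defs.

Local Open Scope classical_set_scope.
Local Open Scope ring_scope.

(** * Angles of plane vectors *)

Section Polar.
Variable R : realType.
Implicit Types p q a b x : R.

(** The tangent at a lowest point is horizontal, but its direction only gives the angle modulo an
    integer; the obstacle is to identify the lift reached by following the isotopy. Chords, rescaled
    by their parameter increment, have a continuous angle on the whole rectangle of times and
    increments, the increment 0 giving the tangent vector. The lift at the final tangent can
    therefore be read along the three other sides: the angle is constant on two of them, and on the
    last one it cannot pass below the horizontal. Half-integers appear as barriers because
    parallelism, with either orientation, is the relation that linear isomorphisms preserve, and a
    vertical vector starts with an integer angle. The hypothesis compares only the two ends of a
    unit of time, so angles are controlled at integer times only, which is enough for a limit along
    integers. The two barriers closest to the initial value -1/4 are -1/2 and 0. *)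

Lemma mul2piK x : 2 * pi * (x / (2 * pi)) = x.
Proof. by rewrite mulrC divfK// mulf_neq0 ?gt_eqF ?pi_gt0. Qed.

Lemma sin_pi_addz x (m : int) : sin (pi * (x + m%:~R)) = 0 <-> sin (pi * x) = 0.
Proof.
have nat_case (y : R) (n : nat) : sin (pi * (y + n%:R)) = 0 <-> sin (pi * y) = 0.
  rewrite mulrDr mulr_natr (alternatingn (@sinDpi R)) -signr_odd.
  by case: (odd n); rewrite ?expr0 ?expr1 ?mul1r// mulN1r; split => [/eqP|->];
    rewrite ?oppr0// oppr_eq0 => /eqP.
case: m => n; first exact: nat_case.
have := nat_case (x + (Negz n)%:~R) n.+1.
by rewrite NegzE mulrNz -addrA -pmulrn addNr addr0 => ->.
Qed.

Lemma sin_pi_eq0 x : sin (pi * x) = 0 <-> x \is a Num.int.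
Proof.
split; last first.
  by move=> /intrP[m ->]; rewrite -[m%:~R]add0r sin_pi_addz mulr0 sin0.
rewrite -{1}(subrK (Num.floor x)%:~R x) sin_pi_addz.
set y := x - _ => sy.
have y0 : 0 <= y by rewrite subr_ge0 floor_le_tmp.
have y1 : y < 1 by rewrite ltrBlDl -intrD1 floorD1_gt.
have [y00|yn0] := eqVneq y 0.
  by move/eqP: y00; rewrite subr_eq0 => /eqP ->; exact: intr_int.
have : 0 < sin (pi * y).
  apply: sin_gt0_pi; rewrite mulr_gt0 ?pi_gt0 ?lt0r ?yn0//=.
  by rewrite -[ltRHS]mulr1 ltr_pM2l ?pi_gt0.
by rewrite sy ltxx.
Qed.

Lemma cos_2pi_eq1 x : cos (2 * pi * x) = 1 <-> x \is a Num.int.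
Proof.
rewrite -sin_pi_eq0 (_ : 2 * pi * x = (pi * x) *+ 2); last by ring.
rewrite cos_mulr2n; split => [h|h].
  by apply/eqP; rewrite -sqrf_eq0 sin2cos2; apply/eqP; lra.
by rewrite cos2sin2 h; ring.
Qed.

(* [a] is the angle, in turns, from the vertical vector to [(p, q)]. *)
Definition polar p q a := exists2 r, 0 < r &
  p = - r * sin (2 * pi * a) /\ q = r * cos (2 * pi * a).

Lemma polar_unique p q a b : polar p q a -> polar p q b -> a - b \is a Num.int.
Proof.
move=> [r r0 [-> ->]] [s s0 [h1 h2]]; apply/cos_2pi_eq1.
rewrite (mulrBr (2 * pi) a b) cosB.
have ha := cos2Dsin2 (2 * pi * a); have hb := cos2Dsin2 (2 * pi * b).
move: h1 h2 ha hb.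
set ca := cos _; set cb := cos _; set sa := sin _; set sb := sin _ => h1 h2 ha hb.
have rs : r = s.
  have : r ^+ 2 = s ^+ 2.
    rewrite -[LHS]mulr1 -ha -[RHS]mulr1 -hb.
    transitivity ((- r * sa) ^+ 2 + (r * ca) ^+ 2); first by ring.
    by rewrite h1 h2; ring.
  by move/eqP; rewrite eqrXn2 ?ltW// => /eqP.
have r_neq0 : r != 0 by rewrite gt_eqF.
move: h1 h2; rewrite -rs => h1 h2.
have {h1}-> : sa = sb by apply: (mulfI r_neq0); lra.
have -> : ca = cb by apply: (mulfI r_neq0); lra.
by rewrite -hb; ring.
Qed.

Lemma trig_2pi_addz a k : k \is a Num.int ->
  sin (2 * pi * (a + k)) = sin (2 * pi * a) /\
  cos (2 * pi * (a + k)) = cos (2 * pi * a).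
Proof.
move=> kZ; have c1 := (cos_2pi_eq1 k).2 kZ.
have s1 : sin (2 * pi * k) = 0.
  have kk : 2 * k \is a Num.int by apply: rpredM => //; exact: natr_int.
  by rewrite -((sin_pi_eq0 _).2 kk); congr sin; ring.
by rewrite (mulrDr (2 * pi) a k) sinD cosD c1 s1 !mulr1 !mulr0 addr0 subr0.
Qed.

Lemma polarDz p q a k : k \is a Num.int -> polar p q a -> polar p q (a + k).
Proof.
move=> kZ [r r0 [-> ->]]; exists r => //.
by have [-> ->] := trig_2pi_addz a kZ.
Qed.

(** Up to sign, the determinant of the two vectors is [r * s * sin (2 * pi * (a - b))];
    half-integers occur because opposite vectors are parallel too. *)
Lemma polar_cross p q a p' q' b : polar p q a -> polar p' q' b ->
  p * q' = q * p' <-> 2 * (a - b) \is a Num.int.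
Proof.
move=> [r r0 [-> ->]] [s s0 [-> ->]]; rewrite -sin_pi_eq0.
rewrite (_ : pi * (2 * (a - b)) = 2 * pi * a - 2 * pi * b); last by ring.
rewrite sinB; have rs : r * s != 0 by rewrite mulf_neq0 ?gt_eqF.
split => [h|/(congr1 ( *%R (r * s))) h]; last by lra.
by apply: (mulfI rs); rewrite mulr0; lra.
Qed.

Lemma polar_exists p q : (p != 0) || (q != 0) -> exists a, polar p q a.
Proof.
move=> pq0.
have n0 : 0 < p ^+ 2 + q ^+ 2.
  rewrite lt0r addr_ge0 ?sqr_ge0// andbT paddr_eq0 ?sqr_ge0// !sqrf_eq0.
  by rewrite negb_and.
pose r := Num.sqrt (p ^+ 2 + q ^+ 2).
have r0 : 0 < r by rewrite sqrtr_gt0.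
have r2 : r ^+ 2 = p ^+ 2 + q ^+ 2 by rewrite sqr_sqrtr ?ltW.
have rn0 : r != 0 by rewrite gt_eqF.
have c1 : -1 <= q / r <= 1.
  rewrite -ler_norml normf_div (gtr0_norm r0) ler_pdivrMr// mul1r.
  by rewrite -sqrtr_sqr ler_wsqrtr// lerDr sqr_ge0.
have cE := @acosK R (q / r); rewrite in_itv/= c1 in cE; have {}cE := cE isT.
have sE : sin (acos (q / r)) = `|p| / r.
  rewrite sin_acos// -[RHS]ger0_norm ?divr_ge0 ?(ltW r0)// -sqrtr_sqr.
  congr Num.sqrt; rewrite !expr_div_n real_normK ?num_real// r2; field.
  by rewrite -r2 expf_neq0.
have [p_ge0|p_lt0] := leP 0 p.
- exists (- acos (q / r) / (2 * pi)); exists r => //.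
  rewrite mul2piK sinN cosN sE cE ger0_norm//; split; field => //.
- exists (acos (q / r) / (2 * pi)); exists r => //.
  rewrite mul2piK sE cE ltr0_norm//; split; field => //.
Qed.

(** Vectors with positive inner product differ by less than a quarter turn, so the arctangent of
    determinant over inner product is the angle between them, continuously and without any choice of
    branch. *)
Lemma polar_step p q p' q' a : polar p q a -> 0 < p * p' + q * q' ->
  polar p' q' (a + atan ((p * q' - q * p') / (p * p' + q * q')) / (2 * pi)).
Proof.
move=> [r r0 [pE qE]]; set d := _ + q * q'; set c := p * q' - _ => d0.
set t := c / d.
have cb0 : 0 < cos (atan t) by rewrite cos_atan invr_gt0 sqrtr_gt0 ltr_pwDl ?sqr_ge0.
have sb : sin (atan t) = t * cos (atan t).
  by rewrite -{2}[t]atanK /tan divfK ?gt_eqF.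
(* The norm of [(p', q')], since the inner product [d] is the product of the two norms and the
   cosine. *)
exists (d / (r * cos (atan t))); first by rewrite divr_gt0 ?mulr_gt0.
rewrite (mulrDr (2 * pi) a) mul2piK.
rewrite sinD cosD sb.
have h1 := cos2Dsin2 (2 * pi * a).
set C := cos (2 * pi * a) in h1 pE qE *; set S := sin (2 * pi * a) in h1 pE qE *.
set k := cos (atan t) in cb0 *.
have dn0 : d != 0 by rewrite gt_eqF.
have rn0 : r != 0 by rewrite gt_eqF.
have kn0 : k != 0 by rewrite gt_eqF.
have E1 : - (d / (r * k)) * (S * k + C * (t * k)) = - (d * S + c * C) / r.
  by rewrite /t; field; rewrite rn0 kn0 dn0.
have E2 : d / (r * k) * (C * k - S * (t * k)) = (d * C - c * S) / r.
  by rewrite /t; field; rewrite rn0 kn0 dn0.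
rewrite E1 E2 /d /c pE qE; split.
  rewrite -[LHS]mulr1 -h1; field => //.
rewrite -[LHS]mulr1 -h1; field => //.
Qed.

Lemma polar_neq0 p q a : polar p q a -> (p != 0) || (q != 0).
Proof.
move=> [r r0 [-> ->]]; rewrite mulNr oppr_eq0 !mulf_eq0 (gt_eqF r0)/= -negb_and.
apply/negP => /andP[/eqP s0 /eqP c0].
by have := cos2Dsin2 (2 * pi * a); rewrite s0 c0; lra.
Qed.

End Polar.

(** * Lifts of angles *)

Section Lift.
Variable R : realType.

Lemma half_notin_int (j : R) : j \is a Num.int -> j + 2^-1 \isn't a Num.int.
Proof.
move=> jZ; apply/negP => hZ.
have : (2^-1 : R) \is a Num.int.
  by rewrite -[2^-1](addKr j) rpredD// rpredN.
move=> /norm_intr_ge1; rewrite ger0_norm ?invr_ge0// => h.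
have := h (lt0r_neq0 _); rewrite invr_gt0 ltr0n => /(_ isT); lra.
Qed.

(* To be applied to the difference [d] of the angles of two vectors moved by
   linear isomorphisms: [2 * d t] is an integer iff they are parallel. *)
Lemma half_int_barrier (d : R -> R) (a b j : R) : a <= b ->
  {within `[a, b], continuous d} -> j \is a Num.int ->
  {in `[a, b] &, forall s t,
     2 * d s \is a Num.int -> 2 * d t \is a Num.int} ->
  2 * d a <= j -> 2 * d b <= j.
Proof.
move=> ab dc jZ dP da; rewrite leNgt; apply/negP => db.
have aI : a \in `[a, b] by rewrite in_itv/= lexx ab.
have bI : b \in `[a, b] by rewrite in_itv/= lexx ab.
have ivt v : 2 * d a <= v <= 2 * d b -> exists2 c, c \in `[a, b] & 2 * d c = v.
  move=> /andP[v1 v2].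
  have [|c cab cE] := @IVT R d a b (v / 2) ab dc.
    by rewrite (min_idPl _) ?(max_idPr _); lra.
  by exists c => //; rewrite cE; lra.
(* Past [j], a non-integer value of [2 * d] is always available: [j + 1/2] if it is reached, and
   otherwise the final value itself. It contradicts the time at which the value is [j]. *)
have [jb|bj] := leP (j + 2^-1) (2 * d b).
  have [|s sI sE] := ivt j; first lra.
  have [|t tI tE] := ivt (j + 2^-1); first lra.
  by have := dP _ _ sI tI; rewrite sE tE (negbTE (half_notin_int jZ)) => /(_ jZ).
have [|s sI sE] := ivt j; first lra.
have := dP _ _ sI bI; rewrite sE => /(_ jZ) bZ.
have := @norm_intr_ge1 _ (2 * d b - j) (rpredB bZ jZ).
rewrite ger0_norm; last lra.
by rewrite subr_eq0 gt_eqF// => /(_ isT); lra.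
Qed.

(** The barrier placed at the initial value applies both to [d] and to [- d]. *)
Lemma int_valued_constant (d : R -> R) (a b : R) : a <= b ->
  {within `[a, b], continuous d} ->
  {in `[a, b], forall t, d t \is a Num.int} -> d b = d a.
Proof.
move=> ab dc dZ.
have d2 (e : R -> R) : {in `[a, b], forall t, e t \is a Num.int} ->
    {in `[a, b] &, forall s t : R,
     2 * e s \is a Num.int -> 2 * e t \is a Num.int}.
  by move=> eZ s t sI tI _; apply: rpredM; [exact: natr_int|exact: eZ].
have aI : a \in `[a, b] by rewrite in_itv/= lexx ab.
have aZ : 2 * d a \is a Num.int by apply: rpredM; [exact: natr_int|exact: dZ].
have le1 := half_int_barrier ab dc aZ (d2 d dZ) (lexx _).
have dNZ : {in `[a, b], forall t, (- d t) \is a Num.int}.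
  by move=> t tI; rewrite rpredN dZ.
have dNc : {within `[a, b], continuous (fun t => - d t)}.
  by move=> t; apply: cvgN; exact: dc.
have aNZ : 2 * - d a \is a Num.int by rewrite mulrN rpredN.
have le2 := half_int_barrier ab dNc aNZ (d2 (fun t => - d t) dNZ) (lexx _).
by lra.
Qed.

(** The retraction of the line onto [[a, b]]: composing with it makes globally continuous a map that
    is controlled only on a box or on [[0, 1]]. *)
Definition clamp (a b x : R) : R := Num.max a (Num.min b x).

Lemma clamp_itv a b x : a <= b -> a <= clamp a b x <= b.
Proof. by move=> ab; rewrite /clamp le_max lexx ge_max ab ge_min lexx. Qed.

Lemma clamp_id a b x : a <= x <= b -> clamp a b x = x.
Proof.
by move=> /andP[ax xb]; rewrite /clamp (min_idPr xb) (max_idPr ax).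
Qed.

Lemma clamp_continuous a b : continuous (clamp a b).
Proof.
move=> x; apply: (@continuous_max R R (cst a)); first exact: cvg_cst.
by apply: (@continuous_min R R (cst b)); [exact: cvg_cst | exact: cvg_id].
Qed.

Lemma fst_continuous (U V : topologicalType) : continuous (@fst U V).
Proof. by case=> u v; exact: cvg_fst. Qed.

Lemma snd_continuous (U V : topologicalType) : continuous (@snd U V).
Proof. by case=> u v; exact: cvg_snd. Qed.

Lemma continuous_pair (T U V : topologicalType) (f : T -> U) (g : T -> V) x :
  {for x, continuous f} -> {for x, continuous g} ->
  {for x, continuous (fun y => (f y, g y))}.
Proof.
by move=> fc gc; exact: (@cvg_pair _ _ _ (nbhs x) (nbhs (f x)) (nbhs (g x))).
Qed.

Definition box (A B : R) : set (R * R) :=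
  [set p | `|p.1| <= A /\ `|p.2| <= B].

Lemma box_compact A B : compact (box A B).
Proof.
have -> : box A B = `[-A, A]%classic `*` `[-B, B]%classic.
  by apply/seteqP; split => p /=; rewrite !in_itv/= -!ler_norml.
by apply: compact_setX; exact: segment_compact.
Qed.

(* [V (k x / N)] and [V ((k + 1) x / N)] make an acute angle for [N] large: the
   angle of [V] is followed along the rays by adding [N] arctangents. *)
Lemma polar_lift (V1 V2 : R * R -> R) (A B : R) : 0 <= A -> 0 <= B ->
  (forall p, box A B p -> {for p, continuous V1}) ->
  (forall p, box A B p -> {for p, continuous V2}) ->
  (forall p, box A B p -> (V1 p != 0) || (V2 p != 0)) ->
  exists2 L : R * R -> R, continuous L &
    forall p, box A B p -> polar (V1 p) (V2 p) (L p).
Proof.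
move=> A0 B0 V1c V2c V0.
pose cl (p : R * R) := (clamp (- A) A p.1, clamp (- B) B p.2).
have clK p : box A B (cl p).
  by split; rewrite /= ler_norml clamp_itv//; lra.
have cl_id p : box A B p -> cl p = p.
  by case: p => s t [/= h1 h2]; rewrite /cl !clamp_id -?ler_norml.
pose sc (t : R) (p : R * R) := (t * p.1, t * p.2).
have scK t p : 0 <= t <= 1 -> box A B p -> box A B (sc t p).
  move=> /andP[t0 t1] [h1 h2]; split; rewrite /= normrM ger0_norm//.
    by rewrite -[A]mul1r ler_pM.
  by rewrite -[B]mul1r ler_pM.
pose dot p q := V1 p * V1 q + V2 p * V2 q.
have [N PN] : exists N : nat, forall p t, box A B p -> 0 <= t <= 1 ->
    0 < dot (sc t p) (sc (t + N.+1%:R^-1) p).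
  have cK : compact (box A B `*` `[0, 1]%classic : set (R * R * R)).
    by apply: compact_setX; [exact: box_compact|exact: segment_compact].
  (* At each point of the compact set, the inner product tends to the squared norm of a nonzero
     vector when [N] tends to infinity and the point varies; compactness makes [N] uniform. *)
  move/compact_near_coveringP : cK.
  move=> /(_ nat \oo (fun (N : nat) z =>
    0 < dot (sc z.2 z.1) (sc (z.2 + N.+1%:R^-1) z.1))) [|N _ PN].
    move=> [p0 t0] [/= p0K]; rewrite in_itv/= => t01.
    have K0 := scK _ _ t01 p0K.
    pose F := filter_prod (nbhs (p0, t0)) (\oo : set_system nat).
    have pt_cvg : x.1 @[x --> F] --> (p0, t0) by exact: cvg_fst.
    have t_cvg : x.1.2 @[x --> F] --> t0.
      exact: (continuous_cvg _ (@snd_continuous _ _ _) pt_cvg).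
    have p_cvg : x.1.1 @[x --> F] --> p0.
      exact: (continuous_cvg _ (@fst_continuous _ _ _) pt_cvg).
    have p1_cvg : x.1.1.1 @[x --> F] --> p0.1.
      exact: (continuous_cvg _ (@fst_continuous _ _ _) p_cvg).
    have p2_cvg : x.1.1.2 @[x --> F] --> p0.2.
      exact: (continuous_cvg _ (@snd_continuous _ _ _) p_cvg).
    have n_cvg : (x.2.+1%:R^-1 : R) @[x --> F] --> (0 : R).
      have s_cvg : x.2 @[x --> F] --> (\oo : set_system nat) by exact: cvg_snd.
      exact: (cvg_comp _ _ s_cvg (@cvg_harmonic R)).
    have sc_cvg (u : (R * R * R) * nat -> R) :
        u x @[x --> F] --> t0 ->
        sc (u x) x.1.1 @[x --> F] --> sc t0 p0.
      move=> uc; apply: (@cvg_pair _ _ _ F (nbhs (t0 * p0.1)) (nbhs (t0 * p0.2))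
          _ _ _ (fun x => u x * x.1.1.1) (fun x => u x * x.1.1.2)); exact: cvgM.
    have c1 := sc_cvg _ t_cvg.
    have c2 : sc (x.1.2 + x.2.+1%:R^-1) x.1.1
        @[x --> F] --> sc t0 p0.
      by apply: sc_cvg; rewrite -[X in _ --> X]addr0; apply: cvgD.
    have : dot (sc x.1.2 x.1.1) (sc (x.1.2 + x.2.+1%:R^-1) x.1.1)
        @[x --> F]
        --> dot (sc t0 p0) (sc t0 p0).
      by apply: cvgD; apply: cvgM; apply: continuous_cvg;
        solve [exact: c1 | exact: c2 | exact: V1c | exact: V2c].
    move/cvgr_gt; apply.
    have := V0 _ K0; rewrite /dot -!expr2 => V00.
    rewrite lt0r addr_ge0 ?sqr_ge0// andbT paddr_eq0 ?sqr_ge0// !sqrf_eq0.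
    by rewrite negb_and.
  exists N => p t pK t01.
  by apply: (PN N (leqnn N) (p, t)); split => //=; rewrite in_itv.
pose h (k : nat) : R := k%:R / N.+1%:R.
have h01 k : (k <= N.+1)%N -> 0 <= h k <= 1.
  by move=> kN; rewrite divr_ge0//= ler_pdivrMr ?ltr0n// mul1r ler_nat.
have {}PN k p : (k <= N)%N -> 0 < dot (sc (h k) (cl p)) (sc (h k.+1) (cl p)).
  move=> kN; have := PN (cl p) (h k) (clK p) (h01 _ (leqW kN)).
  suff -> : h k + N.+1%:R^-1 = h k.+1 by [].
  by rewrite /h -[in RHS]natr1 mulrDl mul1r.
have cl_cont : continuous cl.
  move=> p; apply: (@continuous_pair _ _ _ (fun p => clamp (- A) A p.1)
    (fun p => clamp (- B) B p.2)).
    by apply: continuous_cvg; [exact: clamp_continuous|exact: fst_continuous].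
  by apply: continuous_cvg; [exact: clamp_continuous|exact: snd_continuous].
have sc_cont t : continuous (sc t).
  move=> p; apply: (@continuous_pair _ _ _ (fun p => t * p.1)
    (fun p => t * p.2)); apply: cvgM; try exact: cvg_cst.
    exact: fst_continuous.
  exact: snd_continuous.
have W_cont (W : R * R -> R) k : (forall p, box A B p -> {for p, continuous W}) ->
    (k <= N.+1)%N -> continuous (fun p => W (sc (h k) (cl p))).
  move=> Wc kN p; apply: (@continuous_comp _ _ _ (sc (h k) \o cl) W).
    by apply: continuous_comp; [exact: cl_cont|exact: sc_cont].
  by apply: Wc; apply: scK; [exact: h01|exact: clK].
(* The recursion starts at the centre of the box, where the vector does not depend on [p] and a
   constant angle serves. *)
have step k : (k <= N.+1)%N -> exists2 L : R * R -> R, continuous L &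
    forall p, polar (V1 (sc (h k) (cl p))) (V2 (sc (h k) (cl p))) (L p).
  elim: k => [_|k IH kN].
    have sc0 p : sc (h 0) p = (0, 0) by rewrite /sc /h !mul0r.
    have [a aP] : exists a, polar (V1 (0, 0)) (V2 (0, 0)) a.
      by apply: polar_exists; apply: V0; split; rewrite /= normr0.
    by exists (fun=> a); [move=> ?; exact: cvg_cst | move=> p; rewrite sc0].
  have [L Lc LP] := IH (ltnW kN).
  pose W1 k p := V1 (sc (h k) (cl p)); pose W2 k p := V2 (sc (h k) (cl p)).
  exists (fun p => L p + atan ((W1 k p * W2 k.+1 p - W2 k p * W1 k.+1 p) /
     (W1 k p * W1 k.+1 p + W2 k p * W2 k.+1 p)) / (2 * pi)).
    have W1c i : (i <= N.+1)%N -> continuous (W1 i) by exact: W_cont.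
    have W2c i : (i <= N.+1)%N -> continuous (W2 i) by exact: W_cont.
    move=> p; apply: cvgD; first exact: Lc.
    apply: cvgMl; apply: continuous_cvg; first exact: continuous_atan.
    apply: cvgM.
      apply: cvgB; apply: cvgM; first [exact: W1c|exact: W2c|
        by apply: W1c; exact: ltnW|by apply: W2c; exact: ltnW].
    apply: cvgV; first by rewrite gt_eqF//; exact: PN.
    apply: cvgD; apply: cvgM; first [exact: W1c|exact: W2c|
        by apply: W1c; exact: ltnW|by apply: W2c; exact: ltnW].
  by move=> p; apply: polar_step; [exact: LP|exact: PN].
have [L Lc LP] := step _ (leqnn _).
exists L => // p pK; have := LP p.
by rewrite /h divff ?pnatr_eq0// cl_id// /sc !mul1r; case: (p).
Qed.

End Lift.

(** * The circle *)

Section Circle.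
Variable R : realType.

Lemma circle_piD (a b : R) : circle_pi (a + b) = circle_pi a + circle_pi b.
Proof. exact: (raddfD (\pi_(Quotient.quot (integers R)))%qT). Qed.

Lemma circle_pi_eq (a b : R) : circle_pi a = circle_pi b <-> a - b \is a Num.int.
Proof.
have h : (a - b \is a Num.int) =
    ((\pi a)%qT == (\pi b)%qT :> Quotient.quot (integers R)).
  exact: (@Quotient.idealrBE R (integers R) a b).
rewrite h; split => [e|/eqP e]; [apply/eqP; exact: e|exact: e].
Qed.

Lemma circle_pi_repr (c : circle R) : circle_pi (repr c) = c.
Proof. exact: reprK. Qed.

Lemma circle_pi_continuous : continuous (@circle_pi R).
Proof. exact: pi_continuous. Qed.

Lemma circle_pi_open (U : set R) : open U -> open (@circle_pi R @` U).
Proof.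
move=> oU; rewrite /open/= /quotient_topology.quotient_open.
have -> : (\pi_(circle R) @^-1` (@circle_pi R @` U))%qT
   = \bigcup_(m in [set: int]) ((fun x => x + m%:~R) @^-1` U).
  apply/seteqP; split => x /=.
    move=> [y Uy /circle_pi_eq /intrP[m mE]]; exists m => //=.
    by rewrite -mE addrC subrK.
  move=> [m _ /= Um]; exists (x + m%:~R) => //.
  by apply/circle_pi_eq; rewrite addrC addKr intr_int.
apply: bigcup_open => m _; apply: open_comp => // x _.
by apply: cvgD; [exact: cvg_id|exact: cvg_cst].
Qed.

End Circle.

(** * Column vectors, and lifts of circle-valued maps *)

Section Plane.
Variable R : realType.
Implicit Types (v w z : 'cV[R]_2).

Lemma mulmx2E (m : nat) (M : 'M[R]_(m, 2)) (n : nat) (N : 'M[R]_(2, n)) i j :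
  (M *m N) i j = M i 0 * N 0 j + M i 1 * N 1 j.
Proof.
rewrite mxE big_ord_recl big_ord_recl big_ord0 addr0.
by rewrite (_ : lift ord0 ord0 = 1)//; apply/val_inj.
Qed.

Lemma colP2 v w : v 0 0 = w 0 0 -> v 1 0 = w 1 0 -> v = w.
Proof.
move=> h0 h1; apply/colP => i.
by case: (unliftP 0 i) => [j ->|->//]; rewrite ord1 (_ : lift 0 0 = 1)//; apply/val_inj.
Qed.

Lemma col_neq0 v : (v != 0) = (v 0 0 != 0) || (v 1 0 != 0).
Proof.
apply/idP/idP; last first.
  by apply: contraL => /eqP ->; rewrite !mxE eqxx.
rewrite -negb_and; apply: contra => /andP[/eqP h0 /eqP h1].
by apply/eqP/colP2; rewrite ?h0 ?h1 mxE.
Qed.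

(** [angle] chooses one real representative; the candidates are exactly the [polar] angles, which
    differ by integers, so the class in the circle does not depend on the choice. *)
Lemma polar_angle w a : w != 0 ->
  circle_pi a = angle (chi R) w <-> polar (w 0 0) (w 1 0) a.
Proof.
move=> w0; rewrite /angle; set S := (X in xget 0 X).
have chi1 : enorm (chi R) = 1.
  by rewrite /enorm /chi !mxE/= expr0n/= add0r expr1n sqrtr1.
have wn0 : 0 < enorm w.
  rewrite sqrtr_gt0 lt0r addr_ge0 ?sqr_ge0// andbT paddr_eq0 ?sqr_ge0//.
  by rewrite !sqrf_eq0 negb_and -col_neq0.
have rotE b : rotation b *m chi R = \col_i (if i == 0 then - sin (2 * pi * b) else cos (2 * pi * b)).
  by apply: colP2; rewrite mulmx2E !mxE/=; ring.
have SE b : S b <-> polar (w 0 0) (w 1 0) b.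
  rewrite /S/= chi1 scale1r rotE; split => [wE|[r r0 [pE qE]]].
    by exists (enorm w) => //; rewrite {1}wE {3}wE !mxE/=; split; ring.
  have rE : enorm w = r.
    rewrite /enorm pE qE mulNr sqrrN !exprMn -mulrDr addrC cos2Dsin2 mulr1.
    by rewrite sqrtr_sqr gtr0_norm.
  by rewrite rE; apply: colP2; rewrite ?pE ?qE !mxE/= ?mulrN ?mulNr.
have [b bP] := @polar_exists R (w 0 0) (w 1 0) (etrans (esym (col_neq0 w)) w0).
have xP : S (xget 0 S) by apply: xgetPex; exists b; apply/SE.
move/SE in xP; rewrite circle_pi_eq; split => [hZ|aP].
  by rewrite -(subrK (xget 0 S) a) addrC; apply: polarDz.
exact: polar_unique aP xP.
Qed.

(** A circle-valued map is a field of unit vectors, to which [polar_lift] applies. The field is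
    computed from [repr], and it is continuous because sine and cosine have period one turn and so
    descend to the quotient. *)
Lemma circle_lift (g : R * R -> circle R) (A B : R) : 0 <= A -> 0 <= B ->
  continuous g -> exists2 X : R * R -> R, continuous X &
    forall p, box A B p -> circle_pi (X p) = g p.
Proof.
move=> A0 B0 gc.
have repr_pi (a : R) : repr (circle_pi a) - a \is a Num.int.
  by apply/circle_pi_eq; rewrite circle_pi_repr.
have trig_c (F : R -> R) : continuous F ->
    (forall a k, k \is a Num.int -> F (2 * pi * (a + k)) = F (2 * pi * a)) ->
    continuous (fun c : circle R => F (2 * pi * repr c)).
  move=> Fc FZ; apply/quotient_continuous.
  have -> : (fun c : circle R => F (2 * pi * repr c)) \o (\pi_(circle R))%qT
     = fun a => F (2 * pi * a).
    apply/funext => a /=; rewrite -[in RHS](FZ a _ (repr_pi a)).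
    by rewrite (addrC a) subrK.
  move=> a; apply: (@continuous_comp R R R ( *%R (2 * pi)) F); last exact: Fc.
  by apply: (@cvgM R R (nbhs a)); [exact: cvg_cst | exact: cvg_id].
have cos_c : continuous (fun p => cos (2 * pi * repr (g p))).
  move=> p; apply: (@continuous_comp _ _ _ g (fun c => cos (2 * pi * repr c))).
    exact: gc.
  apply: trig_c => [|a k kZ]; first exact: continuous_cos.
  by case: (trig_2pi_addz a kZ).
have sin_c : continuous (fun p => - sin (2 * pi * repr (g p))).
  move=> p; apply: cvgN.
  apply: (@continuous_comp _ _ _ g (fun c => sin (2 * pi * repr c))).
    exact: gc.
  apply: trig_c => [|a k kZ]; first exact: continuous_sin.
  by case: (trig_2pi_addz a kZ).
have pol p : polar (- sin (2 * pi * repr (g p))) (cos (2 * pi * repr (g p))) (repr (g p)).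
  by exists 1 => //; rewrite mulN1r mul1r.
have [|X Xc XP] := polar_lift A0 B0 (fun p _ => sin_c p) (fun p _ => cos_c p).
  by move=> p _; apply: polar_neq0 (pol p).
exists X => // p pK; rewrite -[RHS]circle_pi_repr; apply/circle_pi_eq.
exact: polar_unique (XP _ pK) (pol p).
Qed.
End Plane.

(** * The universal covering of the annulus *)

Section Cover.
Variable R : realType.
Implicit Types (v w z h : 'cV[R]_2) (x y : annulus R).

Lemma coverD v w : cover (v + w) = cover v + cover w.
Proof. by rewrite /cover !mxE circle_piD. Qed.

Lemma cover_eq v w : cover v = cover w <->
  v 0 0 - w 0 0 \is a Num.int /\ v 1 0 = w 1 0.
Proof.
split => [[/circle_pi_eq h1 h2]//|[/circle_pi_eq h1 h2]].
by rewrite /cover h1 h2.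
Qed.

Lemma cover0 : cover 0 = 0 :> annulus R.
Proof. by apply: (addrI (cover 0)); rewrite -coverD !addr0. Qed.

Lemma cover_surj x : exists v, cover v = x.
Proof.
exists (\col_i if i == 0 then repr x.1 else x.2).
by rewrite /cover !mxE/= circle_pi_repr; case: x.
Qed.

Lemma cvg_col2 (T : Type) (F : set_system T) (FF : Filter F)
    (f : T -> 'cV[R]_2) (l : 'cV[R]_2) :
  f t 0 0 @[t --> F] --> l 0 0 -> f t 1 0 @[t --> F] --> l 1 0 ->
  f t @[t --> F] --> l.
Proof.
move=> /cvg_ballP f0 /cvg_ballP f1; apply/cvg_ballP => e e0.
have n0 := f0 e e0; have n1 := f1 e e0.
near=> t; split => // i j; rewrite (ord1 j).
have [k ->|->] := unliftP 0 i; last by near: t.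
by rewrite (ord1 k) (_ : lift 0 0 = 1); [near: t|exact/val_inj].
Unshelve. all: by end_near. Qed.

Lemma cover_continuous : continuous (@cover R).
Proof.
move=> v; apply: (@continuous_pair _ _ _ (fun v => circle_pi (v 0 0)) (fun v => v 1 0)).
  apply: (@continuous_comp _ _ _ (fun v => v 0 0) (@circle_pi R)).
    exact: coord_continuous.
  exact: circle_pi_continuous.
exact: coord_continuous.
Qed.

(** Carries neighbourhoods in the annulus to the charts in which differentials are defined; one
    direction is continuity of [cover], the other rests on [circle_pi] being open. *)
Lemma nbhs_cover x (P : set (annulus R)) :
  nbhs x P <-> \forall h \near (0 : 'cV[R]_2), P (x + cover h).
Proof.
have [z <-] := cover_surj x; split => [Px|].
  have : {for 0, continuous (fun h => cover (z + h))}.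
    apply: (@continuous_comp _ _ _ (fun h => z + h) (@cover R)).
      by apply: (@cvgD _ _ _ (nbhs (0 : 'cV[R]_2))); [exact: cvg_cst|exact: cvg_id].
    exact: cover_continuous.
  move=> /(_ P); rewrite addr0 => /(_ Px) H.
  rewrite /prop_near1 (_ : (fun h => _) = (fun h => cover (z + h)) @^-1` P)//.
  by apply/funext => h /=; rewrite coverD.
move=> /nbhs_ballP[e /= e0 eP].
exists (@circle_pi R @` ball (z 0 0) e, ball (z 1 0) e).
  split; last exact: nbhsx_ballx.
  apply: open_nbhs_nbhs; split; first exact/circle_pi_open/ball_open.
  by exists (z 0 0) => //; exact: ballxx.
move=> [_ b] [/= [a za <-] zb].
pose h : 'cV[R]_2 := \col_i (if i == 0 then a - z 0 0 else b - z 1 0).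
have := eP h; rewrite -coverD.
rewrite (_ : cover (z + h) = (circle_pi a, b)); last first.
  by rewrite /cover !mxE/= !(addrC _ (_ - _)) !subrK.
apply; split => // i j; rewrite (ord1 j) !mxE.
have [k ->|->] := unliftP 0 i.
  rewrite (ord1 k)/= /ball/= sub0r opprB.
  by move: zb.
by rewrite /ball/= sub0r opprB.
Qed.

(** The fibres are discrete: the first coordinates of the two lifts differ by an integer that tends
    to 0, hence is 0 nearby. *)
Lemma cover_rigid (T : topologicalType) (t0 : T) (F G : T -> 'cV[R]_2) :
  {for t0, continuous F} -> {for t0, continuous G} -> F t0 = G t0 ->
  (\forall t \near t0, cover (F t) = cover (G t)) -> \forall t \near t0, F t = G t.
Proof.
move=> Fc Gc FG0 FG.
have : F t 0 0 - G t 0 0 @[t --> t0] --> F t0 0 0 - G t0 0 0.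
  by apply: cvgB; apply: (@continuous_comp _ _ _ _ (fun v : 'cV[R]_2 => v 0 0)) => //;
    exact: coord_continuous.
rewrite FG0 subrr => /cvgr0Pnorm_lt /(_ 1 ltr01) h.
near=> t; have /cover_eq[hZ h1] : cover (F t) = cover (G t) by near: t.
apply: colP2 => //; apply/eqP; rewrite -subr_eq0.
apply: contraT => /(norm_intr_ge1 hZ); rewrite leNgt => /negP; elim.
by near: t.
Unshelve. all: by end_near. Qed.

End Cover.

(** * Differentials *)

Section Differential.
Variable R : realType.
Implicit Types (v w z : 'cV[R]_2) (x y : annulus R) (f g : annulus R -> annulus R).
Implicit Types (L M : 'M[R]_2).

Lemma is_differential_chart f x L : is_differential f x L ->
  exists F : 'cV[R]_2 -> 'cV[R]_2, [/\ F 0 = 0,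
    \forall h \near (0 : 'cV[R]_2), f (x + cover h) = f x + cover (F h) &
    is_diff (0 : 'cV[R]_2) F (mulmx L)].
Proof.
move=> [F Fnear Fdiff].
have F0 : cover (F 0) = 0.
  have /= := nbhs_singleton Fnear.
  by rewrite cover0 addr0 -[LHS]addr0 => /addrI.
exists (F - cst (F 0)); split.
- by rewrite [LHS]subrr.
- near=> h; have -> : f (x + cover h) = f x + cover (F h) by near: h.
  have -> : cover (F h) = cover ((F - cst (F 0)) h) + cover (F 0).
    by rewrite -coverD; congr cover; rewrite [X in _ = X + _]/GRing.add/= subrK.
  by rewrite F0 addr0.
- by apply: is_diff_eq; rewrite subr0.
Unshelve. all: by end_near. Qed.

Lemma is_differential_continuous f x L : is_differential f x L ->
  {for x, continuous f}.
Proof.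
move=> /is_differential_chart[F [F0 Fnear Fdiff]] O /= fxO.
apply/nbhs_cover.
have Fc : {for 0, continuous F} by apply: differentiable_continuous.
move/nbhs_cover in fxO.
have := Fc _; rewrite F0 => /(_ _ fxO) H.
near=> h; rewrite /preimage/=.
have -> : f (x + cover h) = f x + cover (F h) by near: h.
by near: h.
Unshelve. all: by end_near. Qed.

(** Two local expressions that vanish at 0 have the same projection, so they coincide near 0 by
    [cover_rigid] and have the same directional derivatives. *)
Lemma is_differential_unique f x L M : is_differential f x L ->
  is_differential f x M -> L = M.
Proof.
move=> /is_differential_chart[F [F0 Fnear Fdiff]].
move=> /is_differential_chart[G [G0 Gnear Gdiff]].
have Fc : {for 0, continuous F} by apply: differentiable_continuous.
have Gc : {for 0, continuous G} by apply: differentiable_continuous.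
have FG : \forall h \near (0 : 'cV[R]_2), F h = G h.
  apply: cover_rigid => //; first by rewrite F0 G0.
  near=> h; apply: (addrI (f x)).
  have <- : f (x + cover h) = f x + cover (F h) by near: h.
  by near: h.
have LM v : L *m v = M *m v.
  have FE : 'D_v F 0 = L *m v by rewrite deriveE ?diff_val.
  have GE : 'D_v G 0 = M *m v by rewrite deriveE ?diff_val.
  by rewrite -FE -GE; apply: near_eq_derive.
apply/matrixP => i j; have := LM (delta_mx j 0).
by rewrite -!colE => /colP /(_ i); rewrite !mxE.
Unshelve. all: by end_near. Qed.

Lemma differential_eq f x L : is_differential f x L -> differential f x = L.
Proof.
move=> fL; apply: (@is_differential_unique f x) => //.
by apply: xgetPex; exists L.
Qed.

Lemma is_differential_comp f g x L M : is_differential f x L ->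
  is_differential g (f x) M -> is_differential (g \o f) x (M *m L).
Proof.
move=> /is_differential_chart[F [F0 Fnear Fdiff]].
move=> /is_differential_chart[G [G0 Gnear Gdiff]].
have Fc : {for 0, continuous F} by apply: differentiable_continuous.
exists (G \o F).
  have := Fc _; rewrite F0 => /(_ _ Gnear) H.
  near=> h; rewrite /=; have -> : f (x + cover h) = f x + cover (F h) by near: h.
  by near: h.
rewrite -F0 in Gdiff.
apply: is_diff_eq; apply/funext => h /=; exact: mulmxA.
Unshelve. all: by end_near. Qed.

Lemma is_differential_id x : is_differential id x 1%:M.
Proof.
exists id; first by near=> h.
by apply: is_diff_eq; apply/funext => h; rewrite mul1mx.
Unshelve. all: by end_near. Qed.

(** The lifted image of the horizontal circle and the chart expression along the first basis vector
    have the same projection and agree at [s0]. By rigidity they agree nearby, so the first column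
    of [L] is the velocity of the lifted curve. *)
Lemma is_derive_lift f (r s0 : R) L (X : R -> R) :
  is_differential f (circle_pi s0, r) L -> {for s0, continuous X} ->
  (\forall s \near s0, circle_pi (X s) = (f (circle_pi s, r)).1) ->
  is_derive s0 1 X (L 0 0) /\
  is_derive s0 1 (fun s => (f (circle_pi s, r)).2) (L 1 0).
Proof.
move=> /is_differential_chart[F [F0 Fnear Fdiff]] Xc Xf.
set Y := fun s => _.
pose e1 : 'cV[R]_2 := delta_mx 0 0.
have Le1 i : (L *m e1) i 0 = L i 0 by rewrite -colE mxE.
have curve s : (circle_pi s, r) = (circle_pi s0, r) + cover ((s - s0) *: e1) :> annulus R.
  rewrite (_ : (circle_pi s, r) = cover (\col_i (if i == 0 then s else r))); last first.
    by rewrite /cover !mxE.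
  rewrite (_ : (circle_pi s0, r) = cover (\col_i (if i == 0 then s0 else r))); last first.
    by rewrite /cover !mxE.
  rewrite -coverD; congr cover; apply: colP2; rewrite !mxE/=; ring.
have Fe1 : h^-1 *: F (h *: e1) @[h --> 0^'] --> L *m e1.
  have [dF FE] : derivable F 0 e1 /\ 'D_e1 F 0 = L *m e1.
    by split; [exact: diff_derivable|rewrite deriveE ?diff_val].
  rewrite -FE; move: dF; rewrite /derivable /derive F0.
  by under eq_fun do rewrite /= addr0 subr0.
have cvg0 : (h *: e1) @[h --> (0 : R)] --> (0 : 'cV[R]_2).
  rewrite -[X in _ --> X](scale0r e1).
  by apply: (@cvgZr_tmp _ _ _ (nbhs (0 : R))); exact: cvg_id.
have cvgs : s0 + h @[h --> (0 : R)] --> s0.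
  rewrite -[X in _ --> X]addr0.
  by apply: (@cvgD _ _ _ (nbhs (0:R))); [exact: cvg_cst|exact: cvg_id].
have fc := is_differential_continuous (ex_intro2 _ _ F Fnear Fdiff).
have Yc : {for s0, continuous Y}.
  apply: (@continuous_comp _ _ _ (fun s => f (circle_pi s, r)) snd).
    apply: (@continuous_comp _ _ _ (fun s => (circle_pi s, r) : annulus R) f) => //.
    apply: (@continuous_pair _ _ _ (@circle_pi R) (cst r)).
      exact: circle_pi_continuous.
    exact: cvg_cst.
  exact: snd_continuous.
pose XY s : 'cV[R]_2 := \col_(i < 2) (if i == 0 then X s else Y s).
have XY0 s : cover (XY s) = (circle_pi (X s), Y s) by rewrite /cover !mxE.
have XYc : {for s0, continuous XY}.
  by apply: cvg_col2; under eq_fun do rewrite mxE/=; rewrite mxE/=.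
have Fnear0 : \forall h \near (0 : R), f ((circle_pi s0, r) + cover (h *: e1)) =
   f (circle_pi s0, r) + cover (F (h *: e1)) by exact: cvg0 _ Fnear.
have Xfnear : \forall h \near (0 : R),
   circle_pi (X (s0 + h)) = (f (circle_pi (s0 + h), r)).1 by exact: cvgs _ Xf.
have Fc : {for 0, continuous F} by apply: differentiable_continuous.
have G_eq : \forall h \near (0 : R), XY (s0 + h) = XY s0 + F (h *: e1).
  apply: (@cover_rigid R R 0 (fun h : R => XY (s0 + h))
    (fun h : R => XY s0 + F (h *: e1))).
  - apply: (@continuous_comp _ _ _ (fun h => s0 + h) XY).
      by move: cvgs; rewrite -{2}[s0]addr0.
    by rewrite addr0.
  - apply: (@cvgD _ _ _ (nbhs (0 : R))); first exact: cvg_cst.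
    apply: (@continuous_comp _ _ _ (fun h : R => h *: e1) F).
      by move: cvg0; rewrite -(scale0r e1).
    by rewrite scale0r.
  - by rewrite addr0 scale0r F0 addr0.
  near=> h; rewrite coverD !XY0.
  have -> : circle_pi (X (s0 + h)) = (f (circle_pi (s0 + h), r)).1 by near: h.
  rewrite (nbhs_singleton Xf) /Y -!surjective_pairing (curve (s0 + h)).
  rewrite (_ : s0 + h - s0 = h); last by ring.
  by near: h.
have key i (Z : R -> R) : (\forall h \near (0 : R), Z (s0 + h) = Z s0 + F (h *: e1) i 0) ->
    is_derive s0 1 Z (L i 0).
  move=> ZF; rewrite -Le1.
  have H : h^-1 *: ((Z \o shift s0) (h *: 1) - Z s0) @[h --> 0^'] --> (L *m e1) i 0.
    have := cvg_comp _ _ Fe1 (@coord_continuous R 2 1 i 0 (L *m e1)).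
    apply: cvg_trans; apply: near_eq_cvg.
    apply: nbhs_dnbhs.
    near=> h; rewrite /= mxE; congr (_ * _).
    rewrite addrC [_ *: 1]mulr1 (addrC h).
    have -> : Z (s0 + h) = Z s0 + F (h *: e1) i 0 by near: h.
    ring.
  apply: DeriveDef; first by apply: cvgP; exact: H.
  by apply: cvg_lim; [exact: norm_hausdorff|exact: H].
split; apply: key; near=> h.
  have /(congr1 (fun v : 'cV[R]_2 => v 0 0)) :
    XY (s0 + h) = XY s0 + F (h *: e1) by near: h.
  by rewrite !mxE.
have /(congr1 (fun v : 'cV[R]_2 => v 1 0)) :
  XY (s0 + h) = XY s0 + F (h *: e1) by near: h.
by rewrite !mxE.
Unshelve. all: by end_near. Qed.

End Differential.

(** * Isotopies *)

Section Family.
Variable R : realType.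
Implicit Types (x y : annulus R) (f g : annulus R -> annulus R) (h : R -> annulus R -> annulus R).

(** Joint continuity comes from local compactness: the image [K] of a small closed square is a
    compact neighbourhood of [x0] sent into [O], and by the compact-open topology it is still sent
    into [O] at nearby times. The reparametrization [phi] lets time run over the whole line. *)
Lemma compact_open_joint_continuous (Z : topologicalType)
    (Phi : R -> annulus R -> Z) (phi : R -> R) :
  {within `[0, 1], continuous (Phi : R -> {compact-open, annulus R -> Z})} ->
  (forall t, t \in `[0, 1] -> continuous (Phi t)) ->
  continuous phi -> (forall t, phi t \in `[0, 1]) ->
  continuous (fun p : R * annulus R => Phi (phi p.1) p.2).
Proof.
move=> Phic Phitc phic phi01 [t0 x0] P /=; rewrite nbhsE => -[] O [oO Ox] OP.
have phi_cvg : phi t @[t --> t0] --> within `[0, 1]%classic (nbhs (phi t0)).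
  move=> W WH.
  have H : \forall t \near t0, `[0, 1]%classic (phi t) -> W (phi t) by exact: phic _ WH.
  rewrite nbhs_simpl/=; near=> t.
  have : `[0, 1]%classic (phi t) -> W (phi t) by near: t.
  by apply; exact: phi01.
move/subspace_continuousP: Phic => /(_ (phi t0) (phi01 t0)) Phic0.
have /compact_open_cvgP Psic := cvg_comp _ _ phi_cvg Phic0.
have /nbhs_cover/nbhs_ballP[e /= e0 eO] :
    nbhs x0 [set x | O (Phi (phi t0) x)].
  by apply: Phitc => //; exact: open_nbhs_nbhs.
pose em (p : R * R) : 'cV[R]_2 := \col_(i < 2) if i == 0 then p.1 else p.2.
have em_c : continuous em.
  move=> p; apply: cvg_col2; under eq_fun do rewrite mxE/=; rewrite mxE/=.
    exact: fst_continuous.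
  exact: snd_continuous.
pose K := (fun p => x0 + cover (em p)) @` box (e / 2) (e / 2).
have cK : compact K.
  apply: continuous_compact; last exact: box_compact.
  apply: continuous_subspaceT.
  have [z <-] := cover_surj x0.
  have -> : (fun p => cover z + cover (em p)) = @cover R \o (fun p => z + em p).
    by apply/funext => p; rewrite /= coverD.
  move=> p; apply: continuous_comp; last exact: cover_continuous.
  by apply: (@cvgD _ _ _ (nbhs p)); [exact: cvg_cst|exact: em_c].
have KO : Phi (phi t0) @` K `<=` O.
  move=> _ [_ [p [/= p1 p2] <-] <-]; apply: eO; split => // i j.
  rewrite (ord1 j) /ball/= !mxE sub0r normrN; case: ifP => _.
    by apply: le_lt_trans p1 _; rewrite ltr_pdivrMr// ltr_pMr// ltr1n.
  by apply: le_lt_trans p2 _; rewrite ltr_pdivrMr// ltr_pMr// ltr1n.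
have xK : nbhs x0 K.
  apply/nbhs_cover/nbhs_ballP; exists (e / 2) => /=; first by rewrite divr_gt0.
  move=> v [_ vb]; exists (v 0 0, v 1 0).
    have := vb 0 0; have := vb 1 0; rewrite /ball/= !mxE !sub0r !normrN.
    by split; exact: ltW.
  by congr (_ + cover _); apply: colP2; rewrite !mxE.
exists ([set t | Phi (phi t) @` K `<=` O], K) => /=.
  by split => //; exact: Psic.
by move=> [t x] [/= tK xK']; apply: OP; apply: tK; exists x.
Unshelve. all: by end_near. Qed.

(** What is retained of an isotopy: time is unrestricted, continuity is joint in time and point, and
    function-space topologies no longer appear. Unlike isotopies, these families can be composed at
    each time to reach [[0, n]]. *)
Record C1_family h : Prop := {
  family_continuous : continuous (fun p : R * annulus R => h p.1 p.2);
  family_differential_continuous : forall i j,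
    continuous (fun p : R * annulus R => differential (h p.1) p.2 i j);
  family_differential : forall t x, is_differential (h t) x (differential (h t) x);
  family_unitmx : forall t x, differential (h t) x \in unitmx;
  family_inj : forall t, injective (h t) }.

Lemma C1_family_comp h (g : R -> annulus R -> annulus R) : C1_family h -> C1_family g ->
  C1_family (fun t => g t \o h t).
Proof.
move=> [hc hdc hd hu hi] [gc gdc gd gu gi].
have dE t x : differential (g t \o h t) x =
    differential (g t) (h t x) *m differential (h t) x.
  by apply: differential_eq; apply: is_differential_comp.
have pc : continuous (fun p : R * annulus R => (p.1, h p.1 p.2)).
  move=> p; apply: (@continuous_pair _ _ _ fst (fun p => h p.1 p.2)).
    exact: fst_continuous.
  exact: hc.
split.
- move=> p; apply: (@continuous_comp _ _ _ (fun p => (p.1, h p.1 p.2))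
    (fun p : R * annulus R => g p.1 p.2)); [exact: pc|exact: gc].
- move=> i j.
  rewrite (_ : (fun p => _) = fun p : R * annulus R =>
    differential (g p.1) (h p.1 p.2) i 0 * differential (h p.1) p.2 0 j +
    differential (g p.1) (h p.1 p.2) i 1 * differential (h p.1) p.2 1 j); last first.
    by apply/funext => p; rewrite dE mulmx2E.
  have gcc k : continuous (fun p : R * annulus R => differential (g p.1) (h p.1 p.2) i k).
    move=> p; apply: (@continuous_comp _ _ _ (fun p => (p.1, h p.1 p.2))
      (fun p : R * annulus R => differential (g p.1) p.2 i k)); [exact: pc|exact: gdc].
  by move=> p; apply: cvgD; apply: cvgM; solve [exact: gcc|exact: hdc].
- by move=> t x; rewrite dE; apply: is_differential_comp.
- by move=> t x; rewrite dE unitmx_mul gu hu.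
- by move=> t; apply: inj_comp.
Qed.

Lemma C1_family_id : C1_family (fun=> id).
Proof.
have dE x : differential id x = 1%:M.
  by apply: differential_eq; exact: is_differential_id.
split => //.
- exact: snd_continuous.
- move=> i j; under eq_fun do rewrite dE; move=> p; exact: cvg_cst.
- by move=> t x; rewrite dE; exact: is_differential_id.
- by move=> t x; rewrite dE unitmx1.
- by move=> t x y.
Qed.

Lemma C1_diffeo_unitmx f x : C1_diffeo f -> differential f x \in unitmx.
Proof.
move=> [[fd _] [g [fK gK [gd _]]]].
have := is_differential_comp (fd x) (gd (f x)).
rewrite (_ : g \o f = id); last exact/funext.
move=> /is_differential_unique/(_ (is_differential_id x))/mulmx1_unit.
by case.
Qed.

Lemma C1_family_isotopy f h (phi : R -> R) : isotopy f h -> continuous phi ->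
  (forall t, phi t \in `[0, 1]) -> C1_family (fun t => h (phi t)).
Proof.
move=> [hC1 hc hdc _ _] phic phi01.
have dc t : t \in `[0, 1] -> continuous (differential (h t)).
  by move=> /hC1[[]].
split.
- apply: (@compact_open_joint_continuous _ h phi) => // t /hC1[[hd _] _] x.
  exact: is_differential_continuous (hd x).
- move=> i j p.
  apply: (@continuous_comp _ _ _
    (fun p : R * annulus R => differential (h (phi p.1)) p.2)
    (fun M : 'M[R]_2 => M i j)); last exact: coord_continuous.
  exact: (@compact_open_joint_continuous _ (fun t => differential (h t)) phi).
- by move=> t x; case: (hC1 _ (phi01 t)) => -[].
- by move=> t x; apply: C1_diffeo_unitmx; exact: hC1.
- by move=> t; case: (hC1 _ (phi01 t)) => _ [g [gK _ _]]; exact: can_inj gK.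
Qed.

(* On [0, n], the extended isotopy is the composition of the isotopies
   [t |-> h (clamp 0 1 (t - k))], each at rest outside [k, k + 1]. *)
Lemma extend_isotopy_family f h (n : nat) : isotopy f h ->
  exists H, [/\ C1_family H,
    forall t, 0 <= t <= n%:R -> H t = extend_isotopy f h t &
    forall t, n%:R <= t -> H t = iter n f].
Proof.
move=> hI; have [_ _ _ h0 h1] := hI.
elim: n => [|n [H [HC Hn Hge]]].
  exists (fun=> id); split => // [|t]; first exact: C1_family_id.
  move=> t00; have -> : t = 0 by apply/eqP; rewrite eq_le andbC.
  by rewrite /extend_isotopy truncn0 subr0 h0.
pose phi t : R := clamp 0 1 (t - n%:R).
have phic : continuous phi.
  move=> t; apply: (@continuous_comp R R R (fun t : R => t - n%:R) (clamp 0 1)).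
    by apply: (@cvgB _ _ _ (nbhs t)); [exact: cvg_id|exact: cvg_cst].
  exact: clamp_continuous.
have phi01 t : phi t \in `[0, 1] by rewrite in_itv/= clamp_itv.
exists (fun t => h (phi t) \o H t); split.
- by apply: C1_family_comp => //; apply: (C1_family_isotopy hI).
- move=> t /andP[t0 tn]; have [tlt|tge] := leP t n%:R.
    rewrite -Hn ?t0// /phi /clamp.
    rewrite (max_idPl _) ?h0// ge_min; apply/orP; right.
    by rewrite subr_le0.
  rewrite Hge ?ltW// /phi clamp_id; last by rewrite -natr1 in tn; lra.
  (* At [t = n + 1] the truncation has already jumped: [extend_isotopy] is there [h 0] after [n + 1]
     iterates, which agrees with [h 1] after [n]. *)
  rewrite /extend_isotopy; move: tn; rewrite le_eqVlt => /orP[/eqP ->|tlt].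
    by rewrite natrK subrr h0 -natr1 addrC addKr h1.
  suff -> : Num.truncn t = n by [].
  by apply/eqP; rewrite truncn_eq// ltW.
- move=> t tn; rewrite Hge; last by apply: le_trans tn; rewrite ler_nat.
  have -> : phi t = 1.
    rewrite /phi /clamp (min_idPl _) ?(max_idPr _)//.
    by rewrite -natr1 in tn; lra.
  by rewrite h1; apply/funext => x.
Qed.

End Family.

(** * Chords of the image of a horizontal circle *)

Section Chords.
Variable R : realType.

Lemma int_valued_constant_itv (d : R -> R) (a b x y : R) :
  continuous d -> (forall t, a <= t <= b -> d t \is a Num.int) ->
  a <= x <= b -> a <= y <= b -> d x = d y.
Proof.
move=> dc dZ /andP[ax xb] /andP[ay yb].
have H z : a <= z -> z <= b -> d z = d a.
  move=> az zb; apply: int_valued_constant => //.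
    exact: continuous_subspaceT.
  move=> t; rewrite in_itv/= => /andP[h1 h2]; apply: dZ.
  by rewrite h1 (le_trans h2).
by rewrite !H.
Qed.

(** A chord vanishes with its increment and then has no angle; divided by the increment, it extends
    continuously by the tangent vector. *)
Definition slope (Z dZ : R * R -> R) (s0 : R) (p : R * R) : R :=
  if p.2 == 0 then dZ (p.1, s0) else (Z (p.1, s0 + p.2) - Z (p.1, s0)) / p.2.

(** At increment 0, the mean value theorem turns each nearby quotient into a value of [dZ] at an
    intermediate point, and [dZ] is jointly continuous. *)
Lemma slope_continuous (Z dZ : R * R -> R) (A s0 t0 d0 : R) :
  continuous Z -> continuous dZ ->
  (forall t s : R, `|t| < A -> `|s| < A -> is_derive s 1 (fun s => Z (t, s)) (dZ (t, s))) ->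
  `|t0| < A -> `|s0| < A -> {for (t0, d0), continuous (slope Z dZ s0)}.
Proof.
move=> Zc dZc ZdZ t0A s0A.
have fst_c := @fst_continuous R R (t0, d0).
have snd_c := @snd_continuous R R (t0, d0).
have quot_c : {for (t0, d0), continuous
    (fun p : R * R => Z (p.1, s0 + p.2) - Z (p.1, s0))}.
  apply: (@cvgB _ _ _ (nbhs (t0, d0))).
    apply: (@continuous_comp _ _ _ (fun p : R * R => (p.1, s0 + p.2)) Z); last exact: Zc.
    apply: (@continuous_pair _ _ _ fst (fun p : R * R => s0 + p.2)) => //.
    by apply: (@cvgD _ _ _ (nbhs (t0, d0))); [exact: cvg_cst|exact: snd_c].
  apply: (@continuous_comp _ _ _ (fun p : R * R => (p.1, s0)) Z); last exact: Zc.
  by apply: (@continuous_pair _ _ _ fst (fun p : R * R => s0)) => //; exact: cvg_cst.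
have [d00|dn0] := eqVneq d0 0; last first.
  have : (Z (p.1, s0 + p.2) - Z (p.1, s0)) / p.2 @[p --> (t0, d0)] -->
      slope Z dZ s0 (t0, d0).
    rewrite /slope/= (negbTE dn0); apply: cvgM; first exact: quot_c.
    by apply: cvgV => //; exact: snd_c.
  apply: cvg_trans; apply: near_eq_cvg; near=> p.
  rewrite /slope ifF//; apply/negbTE.
  by near: p; exact: (cvgr_neq0 _ snd_c).
rewrite d00 in fst_c snd_c quot_c *.
have slope0 : slope Z dZ s0 (t0, 0) = dZ (t0, s0) by rewrite /slope eqxx.
apply/cvgrPdist_lt => e e0; rewrite slope0.
have := dZc (t0, s0) _ (nbhsx_ballx (dZ (t0, s0)) e e0).
move=> /nbhs_ballP[n /= n0 dZn].
have n1 : \forall p \near (t0, 0 : R), ball t0 n p.1.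
  by apply: (fst_c (ball t0 n)); exact: nbhsx_ballx.
have n2 : \forall p \near (t0, 0 : R), ball (0 : R) n p.2.
  by apply: (snd_c (ball (0 : R) n)); exact: nbhsx_ballx.
have n3 : \forall p \near (t0, 0 : R), `|p.1| < A.
  exact: (cvgr_norm_lt _ fst_c).
(* Keeps the segment from [s0] to [s0 + p.2] in the range where [dZ] is known to be the
   derivative. *)
have n4 : \forall p \near (t0, 0 : R), `|p.2| < A - `|s0|.
  by apply: (cvgr_norm_lt _ snd_c); rewrite normr0 subr_gt0.
near=> p.
have p1 : ball t0 n p.1 by near: p.
have p2 : ball (0 : R) n p.2 by near: p.
have p3 : `|p.1| < A by near: p.
have p4 : `|p.2| < A - `|s0| by near: p.
have dZe c : `|c - s0| < n -> `|dZ (t0, s0) - dZ (p.1, c)| < e.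
  by move=> cn; apply: dZn; split => //=; rewrite /ball/= distrC.
rewrite /slope; have [_|pn0] := eqVneq p.2 0; first by apply: dZe; rewrite subrr normr0.
have p2n : `|p.2| < n by move: p2; rewrite /ball/= sub0r normrN.
have mvt a b : a < b -> `|a - s0| <= `|p.2| -> `|b - s0| <= `|p.2| ->
    exists2 c, `|c - s0| < n & Z (p.1, b) - Z (p.1, a) = dZ (p.1, c) * (b - a).
  move=> ab aA bA.
  have cA c : a <= c <= b -> `|c - s0| <= `|p.2|.
    by move: aA bA; rewrite !ler_norml; lra.
  have [|||c cab ->] := @MVT_segment R (fun s => Z (p.1, s)) (fun s => dZ (p.1, s)) a b.
  - exact: ltW.
  - move=> x; rewrite in_itv/= => /andP[ax xb]; apply: ZdZ => //.
    have := cA x; rewrite (ltW ax) (ltW xb) => /(_ isT) h.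
    by have := ler_normD (x - s0) s0; rewrite subrK; lra.
  - apply: continuous_subspaceT => x.
    apply: (@continuous_comp _ _ _ (fun s => (p.1, s)) Z); last exact: Zc.
    by apply: (@continuous_pair _ _ _ (cst p.1) id); [exact: cvg_cst|exact: cvg_id].
  exists c => //; apply: le_lt_trans p2n; apply: cA.
  by move: cab; rewrite in_itv.
have [p_lt|p_gt|p_eq] := ltgtP p.2 0; last by rewrite p_eq eqxx in pn0.
  have [|||c cn cE] := mvt (s0 + p.2) s0; first lra.
  - by rewrite addrC addKr.
  - by rewrite subrr normr0.
  have -> : (Z (p.1, s0 + p.2) - Z (p.1, s0)) / p.2 = dZ (p.1, c).
    rewrite -opprB cE; field => //.
  exact: dZe.
have [|||c cn cE] := mvt s0 (s0 + p.2); first lra.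
- by rewrite subrr normr0.
- by rewrite addrC addKr.
have -> : (Z (p.1, s0 + p.2) - Z (p.1, s0)) / p.2 = dZ (p.1, c).
  rewrite cE; field => //.
exact: dZe.
Unshelve. all: by end_near. Qed.

End Chords.

(** * The tangent angle at a lowest point of the image curve *)

Section LowestPoint.
Variable R : realType.

Lemma unitmx2_neq0 (M : 'M[R]_2) : M \in unitmx ->
  M 0 0 * M 1 1 - M 0 1 * M 1 0 != 0.
Proof.
move=> Mu; set N := invmx M.
have MN i j : M i 0 * N 0 j + M i 1 * N 1 j = (i == j)%:R.
  by rewrite -mulmx2E mulmxV// mxE.
have : (M 0 0 * M 1 1 - M 0 1 * M 1 0) * (N 0 0 * N 1 1 - N 0 1 * N 1 0) = 1.
  transitivity ((M 0 0 * N 0 0 + M 0 1 * N 1 0) * (M 1 0 * N 0 1 + M 1 1 * N 1 1)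
    - (M 0 0 * N 0 1 + M 0 1 * N 1 1) * (M 1 0 * N 0 0 + M 1 1 * N 1 0)); first by ring.
  by rewrite !MN/= mulr1 mul0r subr0.
by apply: contra_eq_neq => ->; rewrite mul0r eq_sym oner_neq0.
Qed.

Lemma circle_pi_addz (s k : R) : k \is a Num.int -> circle_pi (s + k) = circle_pi s.
Proof. by move=> kZ; apply/circle_pi_eq; rewrite addrC addKr. Qed.

Lemma polar_right (a : R) : polar 1 0 a <-> a + 4^-1 \is a Num.int.
Proof.
have base : polar 1 0 (- 4^-1 : R).
  exists 1 => //; rewrite (_ : 2 * pi * - 4^-1 = - (pi / 2)); last by field.
  by rewrite sinN cosN sin_pihalf cos_pihalf; split; ring.
split => [h|hZ]; first by have := polar_unique h base; rewrite opprK.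
by have := polarDz hZ base; rewrite addrC addrK.
Qed.

(** A forbidden window just below the rightward direction, to be met by an intermediate value
    argument; [3 / 8] only has to keep it inside the lower half-plane. *)
Lemma polar_upper (p q a : R) : polar p q a -> 0 <= q -> ~ (- (3 / 8) <= a < - 4^-1).
Proof.
move=> [r r0 [_ ->]]; rewrite pmulr_rge0// => + /andP[a1 a2].
have pi0 := pi_gt0 R.
rewrite -cosN leNgt => /negP; apply; rewrite -(cos_pihalf R).
rewrite ltr_cos ?in_itv/=; first nra.
  by apply/andP; split; nra.
by apply/andP; split; nra.
Qed.

(* The chords of the image curve issued from a lowest point stay in the closed
   upper half-plane, and they join the tangent vector to the deck translation. *)
Lemma lowest_point_angle (h : R -> annulus R -> annulus R) (T r : R) :
  C1_family h -> h 0 = id -> 0 <= T ->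
  exists2 s, 0 <= s <= 1 & forall b : R -> R,
    {within `[0, T], continuous b} ->
    (forall t, 0 <= t <= T -> polar (differential (h t) (circle_pi s, r) 0 0)
       (differential (h t) (circle_pi s, r) 1 0) (b t)) ->
    b 0 = - 4^-1 -> - 4^-1 <= b T.
Proof.
move=> hC h0 T0.
pose gam (s : R) : annulus R := (circle_pi s, r).
have gam_c : continuous (fun p : R * R => (p.1, gam p.2)).
  move=> p; apply: (@continuous_pair _ _ _ fst (fun p : R * R => gam p.2)).
    exact: fst_continuous.
  apply: (@continuous_pair _ _ _ (fun p : R * R => circle_pi p.2) (fun p : R * R => r)).
    apply: (@continuous_comp _ _ _ snd (@circle_pi R)); first exact: snd_continuous.
    exact: circle_pi_continuous.
  exact: cvg_cst.
have img_c : continuous (fun p : R * R => h p.1 (gam p.2)).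
  move=> p; apply: (@continuous_comp _ _ _ (fun p : R * R => (p.1, gam p.2))
    (fun p : R * annulus R => h p.1 p.2)); first exact: gam_c.
  exact: family_continuous hC _.
pose D i (p : R * R) := differential (h p.1) (gam p.2) i 0.
have D_c i : continuous (D i).
  move=> p; apply: (@continuous_comp _ _ _ (fun p : R * R => (p.1, gam p.2))
    (fun p : R * annulus R => differential (h p.1) p.2 i 0)); first exact: gam_c.
  exact: (family_differential_continuous hC).
(* Leaves room for [s0 + d] with [|d| <= 1], and for strict inequalities around all times up to
   [T]. *)
pose A := T + 4; have A0 : 0 <= A by rewrite /A; lra.
have [X Xc Xpi] := circle_lift A0 A0 (fun p =>
  @continuous_comp _ _ _ (fun p : R * R => h p.1 (gam p.2)) fst p (img_c p)
    (@fst_continuous _ _ _)).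
pose Y (p : R * R) := (h p.1 (gam p.2)).2.
have Yc : continuous Y.
  move=> p; apply: (@continuous_comp _ _ _ (fun p : R * R => h p.1 (gam p.2)) snd).
    exact: img_c.
  exact: snd_continuous.
have XYD (t s : R) : `|t| < A -> `|s| < A ->
    is_derive s 1 (fun s => X (t, s)) (D 0 (t, s)) /\
    is_derive s 1 (fun s => Y (t, s)) (D 1 (t, s)).
  move=> tA sA; apply: (is_derive_lift (family_differential hC t (gam s))).
    apply: (@continuous_comp _ _ _ (fun s => (t, s)) X); last exact: Xc.
    by apply: (@continuous_pair _ _ _ (cst t) id); [exact: cvg_cst|exact: cvg_id].
  have s_cvg : s' @[s' --> s] --> s by exact: cvg_id.
  have sn : \forall s' \near s, `|s'| < A by exact: (cvgr_norm_lt _ s_cvg).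
  near=> s'; apply: Xpi; split => /=; first exact: ltW.
  by apply: ltW; near: s'.
have [s0 s01 s0min] : exists2 s0 : R, 0 <= s0 <= 1 &
    forall s, 0 <= s <= 1 -> Y (T, s0) <= Y (T, s).
  have [||s0 s01 sm] := @EVT_min R (fun s => Y (T, s)) 0 1; first exact: ler01.
    apply: continuous_subspaceT => s.
    apply: (@continuous_comp _ _ _ (fun s => (T, s)) Y); last exact: Yc.
    by apply: (@continuous_pair _ _ _ (cst T) id); [exact: cvg_cst|exact: cvg_id].
  by exists s0 => [|s sI]; [move: s01; rewrite in_itv|apply: sm; rewrite in_itv].
exists s0 => // b bc bD b0.
have Ymin d : 0 <= d <= 1 -> Y (T, s0 + d) >= Y (T, s0).
  move=> d01; have [sd|sd] := leP (s0 + d) 1; first by apply: s0min; lra.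
  rewrite -[s0 + d](subrK 1) /Y/= /gam circle_pi_addz ?int_num1//.
  by apply: (s0min (s0 + d - 1)); lra.
pose W1 := slope X (D 0) s0; pose W2 := slope Y (D 1) s0.
have s0A : `|s0| < A by rewrite ger0_norm /A; lra.
have W1c p : box T 1 p -> {for p, continuous W1}.
  case: p => t d [/= tT d1]; apply: (@slope_continuous _ _ _ A) => //.
    by move=> t' s' t'A s'A; case: (XYD t' s' t'A s'A).
  by rewrite /A; lra.
have W2c p : box T 1 p -> {for p, continuous W2}.
  case: p => t d [/= tT d1]; apply: (@slope_continuous _ _ _ A) => //.
    by move=> t' s' t'A s'A; case: (XYD t' s' t'A s'A).
  by rewrite /A; lra.
have Xdiff (d : R) : `|d| <= 1 -> continuous (fun t => X (t, s0 + d) - X (t, s0)).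
  move=> d1 t; apply: (@cvgB _ _ _ (nbhs t)).
    apply: (@continuous_comp _ _ _ (fun t => (t, s0 + d)) X); last exact: Xc.
    by apply: (@continuous_pair _ _ _ id (cst (s0 + d))); [exact: cvg_id|exact: cvg_cst].
  apply: (@continuous_comp _ _ _ (fun t => (t, s0)) X); last exact: Xc.
  by apply: (@continuous_pair _ _ _ id (cst s0)); [exact: cvg_id|exact: cvg_cst].
have boxA t d : `|t| <= T -> `|d| <= 1 -> box A A (t, s0 + d).
  move=> tT d1; split => /=; first by rewrite /A; lra.
  by have := ler_normD s0 d; rewrite (ger0_norm (proj1 (andP s01))) /A; lra.
have boxA0 t : `|t| <= T -> box A A (t, s0).
  by move=> tT; have := @boxA t 0 tT; rewrite normr0 addr0; apply; exact: ler01.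
have X0 d : `|d| <= 1 -> X (0, s0 + d) - X (0, s0) = d.
  move=> d1.
  have Z0 s : s0 - 1 <= s <= s0 + 1 -> X (0, s) - s \is a Num.int.
    move=> sI; apply/circle_pi_eq; rewrite (_ : s = s0 + (s - s0)); last by ring.
    rewrite Xpi; first by rewrite /= h0.
    by apply: boxA; rewrite ?normr0// ler_norml; lra.
  have Zc : continuous (fun s => X (0, s) - s).
    move=> s; apply: (@cvgB _ _ _ (nbhs s)); last exact: cvg_id.
    apply: (@continuous_comp _ _ _ (fun s => (0, s)) X); last exact: Xc.
    by apply: (@continuous_pair _ _ _ (cst 0) id); [exact: cvg_cst|exact: cvg_id].
  move: d1; rewrite ler_norml => d1.
  by have := int_valued_constant_itv Zc Z0 (x := s0 + d) (y := s0); lra.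
(* The ends of such a chord have the same projection, so its horizontal component is an integer; by
   continuity it keeps its value at time 0, which is [d]. *)
have Xint t d : `|t| <= T -> `|d| <= 1 -> d \is a Num.int ->
    X (t, s0 + d) - X (t, s0) = d.
  move=> tT d1 dZ; rewrite -[RHS]X0//.
  apply: (int_valued_constant_itv (a := - T) (b := T) (Xdiff _ d1)).
  - move=> t' t'T; have {}t'T : `|t'| <= T by rewrite ler_norml.
    apply/circle_pi_eq; rewrite !Xpi; [|exact: boxA0|exact: boxA].
    by rewrite /= /gam circle_pi_addz.
  - by rewrite -ler_norml.
  - by rewrite -ler_norml normr0.
have Yint t d : d \is a Num.int -> Y (t, s0 + d) = Y (t, s0).
  by move=> dZ; rewrite /Y/= /gam circle_pi_addz.
(* At increment 0 the differential is invertible. Elsewhere a zero chord would force [d] to be an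
   integer, by injectivity, and then [Xint] gives the chord the nonzero component [d]. *)
have W0 p : box T 1 p -> (W1 p != 0) || (W2 p != 0).
  case: p => t d [/= tT d1]; rewrite /W1 /W2 /slope/=.
  have [d0|dn0] := eqVneq d 0.
    have := family_unitmx hC t (gam s0).
    move=> /unitmx2_neq0; apply: contraTT.
    rewrite negb_or !negbK /D/= => /andP[/eqP -> /eqP ->].
    by rewrite mul0r mulr0 subr0.
  rewrite -negb_and; apply/negP => /andP[].
  rewrite !mulf_eq0 invr_eq0 (negbTE dn0) !orbF !subr_eq0 => /eqP Xe /eqP Ye.
  have : h t (gam (s0 + d)) = h t (gam s0).
    rewrite (surjective_pairing (h t (gam (s0 + d)))) (surjective_pairing (h t (gam s0))).
    congr (_, _); last exact: Ye.
    have /= <- := Xpi (t, s0 + d) (boxA _ _ tT d1).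
    by rewrite Xe (Xpi (t, s0) (boxA0 _ tT)).
  move=> /(family_inj hC)/(congr1 fst)/=/circle_pi_eq.
  rewrite addrC addKr => dZ.
  by have := Xint _ _ tT d1 dZ; rewrite Xe subrr => d0; rewrite -d0 eqxx in dn0.
have [L Lc LW] := polar_lift T0 ler01 W1c W2c W0.
have W_right t d : `|t| <= T -> 0 < d <= 1 -> X (t, s0 + d) - X (t, s0) = d ->
   Y (t, s0 + d) = Y (t, s0) -> L (t, d) + 4^-1 \is a Num.int.
  move=> tT /andP[d0 d1] Xe Ye.
  have dn : `|d| <= 1 by rewrite gtr0_norm.
  have := LW (t, d) (conj tT dn).
  by rewrite /W1 /W2 /slope/= gt_eqF// Xe Ye subrr mul0r divff ?gt_eqF// => /polar_right.
have T_norm t : 0 <= t <= T -> `|t| <= T.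
  by move=> /andP[t0 tT]; rewrite ger0_norm.
have b0D := bD 0; rewrite lexx T0 b0 in b0D; have {}b0D := b0D isT.
have W_diag t : `|t| <= T -> polar (D 0 (t, s0)) (D 1 (t, s0)) (L (t, 0)).
  move=> tT; have := LW (t, 0); rewrite /W1 /W2 /slope/= eqxx; apply.
  by split => //=; rewrite normr0.
have L00 : L (0, 0) + 4^-1 \is a Num.int.
  have := polar_unique (W_diag 0 _) b0D; rewrite opprK; apply.
  by rewrite normr0.
have Lt_c d : continuous (fun t => L (t, d)).
  move=> t; apply: (@continuous_comp _ _ _ (fun t => (t, d)) L); last exact: Lc.
  by apply: (@continuous_pair _ _ _ id (cst d)); [exact: cvg_id|exact: cvg_cst].
have Ld_c t : continuous (fun d => L (t, d)).
  move=> d; apply: (@continuous_comp _ _ _ (fun d => (t, d)) L); last exact: Lc.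
  by apply: (@continuous_pair _ _ _ (cst t) id); [exact: cvg_cst|exact: cvg_id].
have shift_c (g : R -> R) k : continuous g -> continuous (fun t => g t + k).
  by move=> gc t; apply: (@cvgD _ _ _ (nbhs t)); [exact: gc|exact: cvg_cst].
have I0 : 0 <= (0 : R) <= 1 by rewrite ?lexx ?ler01.
have I1 : 0 <= (1 : R) <= 1 by rewrite ?lexx ?ler01.
have J0 : 0 <= (0 : R) <= T by rewrite ?lexx ?T0.
have JT : 0 <= T <= T by rewrite ?lexx ?T0.
(* Two sides of the rectangle: the chords at time 0, then the chord to the deck translate at all
   times. Both point to the right, so [L] is constant along them. *)
have L01 : L (0, 1) = L (0, 0).
  apply: (@addIr R (4^-1)); apply: (int_valued_constant_itv (a := 0) (b := 1)
    (d := fun d => L (0, d) + 4^-1)) => //; first exact: shift_c.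
  move=> d /andP[d0 d1]; have [d00|dn0] := eqVneq d 0; first by rewrite d00.
  apply: W_right; rewrite ?normr0 ?lt0r ?dn0 ?d0//.
    by apply: X0; rewrite ger0_norm.
  by rewrite /Y/= h0.
have LT1 : L (T, 1) = L (0, 1).
  apply: (@addIr R (4^-1)); apply: (int_valued_constant_itv (a := 0) (b := T)
    (d := fun t => L (t, 1) + 4^-1)) => //; first exact: shift_c.
  move=> t /T_norm tT; apply: W_right => //; first by rewrite ltr01 lexx.
    by apply: Xint; rewrite ?normr1// int_num1.
  by apply: Yint; exact: int_num1.
have bL : b T = L (T, 0) - (L (0, 0) + 4^-1).
  suff : b T - L (T, 0) = b 0 - L (0, 0) by rewrite b0; lra.
  apply: (int_valued_constant (d := fun t => b t - L (t, 0))) => //.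
    move=> t; apply: cvgB; first exact: bc.
    exact: (@continuous_subspaceT _ _ _ (fun t => L (t, 0)) (Lt_c 0)).
  move=> t; rewrite in_itv/= => t0T.
  by apply: polar_unique (bD _ t0T) (W_diag _ (T_norm _ t0T)).
rewrite leNgt; apply/negP => bT.
set k := L (0, 0) + 4^-1 in L00 bL.
(* From increment 0 to 1 at time [T], the normalized angle goes from [b T] to -1/4; if [b T] were
   smaller, it would enter the forbidden window. The strict inequality [b T < v] excludes [d = 0],
   where [W2] is a derivative and not the slope of a chord. *)
have [v v1 vT] : exists2 v, - (3 / 8) <= v < - 4^-1 & b T < v.
  exists ((Num.max (- (3 / 8)) (b T) - 4^-1) / 2).
    have : - (3 / 8) <= Num.max (- (3 / 8)) (b T) < - 4^-1.
      by rewrite le_max lexx/= gt_max bT andbT; lra.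
    by move: (Num.max _ _) => m; lra.
  have : b T <= Num.max (- (3 / 8)) (b T) < - 4^-1.
    by rewrite le_max lexx orbT/= gt_max bT andbT; lra.
  by move: (Num.max _ _) => m; lra.
have [||d dI dE] := @IVT R (fun d => L (T, d) - k) 0 1 v ler01.
- exact/continuous_subspaceT/shift_c.
- rewrite LT1 L01 -bL (_ : L (0, 0) - k = - 4^-1); last by rewrite /k; ring.
  by rewrite (min_idPl _) ?(max_idPr _) ?(ltW bT)// (ltW vT); lra.
have dn0 : d != 0.
  by apply/eqP => d0; move: dE vT; rewrite d0 -bL => ->; rewrite ltxx.
rewrite in_itv/= in dI.
have dn : `|d| <= 1 by rewrite ger0_norm; lra.
have := LW (T, d) (conj (T_norm _ JT) dn).
have kN : - k \is a Num.int by rewrite rpredN.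
move=> /(polarDz kN); rewrite dE => /polar_upper; apply => //.
rewrite /W2 /slope/= (negbTE dn0).
by rewrite divr_ge0 ?subr_ge0 ?Ymin//; lra.
Unshelve. all: by end_near. Qed.

End LowestPoint.

(** * Torsion *)

Section Torsion.
Variable R : realType.
Variables (f : annulus R -> annulus R) (I : R -> annulus R -> annulus R).
Hypothesis hI : isotopy f I.
Implicit Types (x : annulus R) (xi : 'cV[R]_2).

Local Notation ext := (extend_isotopy f I).

Lemma within_comp (A B : set R) (g phi : R -> R) :
  {within A, continuous g} -> continuous phi -> (forall t, B t -> A (phi t)) ->
  {within B, continuous (fun t => g (phi t))}.
Proof.
move=> gc phic BA; apply/subspace_continuousP => t Bt.
have phi_cvg : phi s @[s --> within B (nbhs t)] --> within A (nbhs (phi t)).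
  move=> W WA.
  have H : \forall s \near t, A (phi s) -> W (phi s) by exact: phic _ WA.
  by apply: (filterS _ H) => s Hs Bs; apply: Hs; exact: BA.
move/subspace_continuousP: gc => /(_ _ (BA t Bt)) gc.
exact: (cvg_comp _ _ phi_cvg gc).
Qed.

Lemma extend_isotopy_nat (n : nat) : ext n%:R = iter n f.
Proof.
have [_ _ _ I0 _] := hI.
by rewrite /extend_isotopy natrK subrr I0.
Qed.

Lemma extend_isotopyD (n : nat) (t : R) : 0 <= t ->
  ext (n%:R + t) = ext t \o iter n f.
Proof.
move=> t0; rewrite /extend_isotopy.
have -> : Num.truncn (n%:R + t) = (Num.truncn t + n)%N.
  apply: truncn_def; have := truncn_itv t0.
  by rewrite -!natr1 natrD; lra.
apply/funext => x /=; rewrite iterD natrD; congr I; ring.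
Qed.

Lemma extend_isotopy_differential t x : 0 <= t ->
  is_differential (ext t) x (differential (ext t) x) /\
  differential (ext t) x \in unitmx.
Proof.
move=> t0.
have [H [HC Hn _]] := extend_isotopy_family (Num.truncn t).+1 hI.
have -> : ext t = H t.
  by rewrite Hn// t0 ltW// truncnS_gt.
by split; [exact: family_differential|exact: family_unitmx].
Qed.

Lemma extend_isotopy_differentialD (n : nat) t x : 0 <= t ->
  differential (ext (n%:R + t)) x =
  differential (ext t) (iter n f x) *m differential (ext n%:R) x.
Proof.
move=> t0; apply: differential_eq; rewrite extend_isotopyD// -extend_isotopy_nat.
apply: is_differential_comp; first by apply: (extend_isotopy_differential _ _).1; exact: ler0n.
exact: (extend_isotopy_differential _ _).1.
Qed.

Lemma differential_extend_isotopy0 x : differential (ext 0) x = 1%:M.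
Proof.
by rewrite (extend_isotopy_nat 0); apply: differential_eq; exact: is_differential_id.
Qed.

(** The determinant of the two images is the nonzero determinant of [M t] times that of [xi] and
    [xi']: parallel at one time means parallel at all times, as the barrier requires. *)
Lemma polar_barrier (M : R -> 'M[R]_2) (xi xi' : 'cV[R]_2) (v w : R -> R) (a b j : R) :
  a <= b -> j \is a Num.int ->
  (forall t, a <= t <= b -> M t \in unitmx) ->
  {within `[a, b], continuous v} -> {within `[a, b], continuous w} ->
  (forall t, a <= t <= b -> polar ((M t *m xi) 0 0) ((M t *m xi) 1 0) (v t)) ->
  (forall t, a <= t <= b -> polar ((M t *m xi') 0 0) ((M t *m xi') 1 0) (w t)) ->
  2 * (v a - w a) <= j -> 2 * (v b - w b) <= j.
Proof.
move=> ab jZ Mu vc wc vM wM.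
apply: (half_int_barrier (d := fun t => v t - w t)) => //.
  by move=> t; apply: cvgB; [exact: vc|exact: wc].
have par t : a <= t <= b -> 2 * (v t - w t) \is a Num.int <->
    xi 0 0 * xi' 1 0 = xi 1 0 * xi' 0 0.
  move=> tab; rewrite -(polar_cross (vM t tab) (wM t tab)) !mulmx2E.
  have cn0 := unitmx2_neq0 (Mu t tab); move: cn0.
  move: (M t 0 0) (M t 0 1) (M t 1 0) (M t 1 1) => m00 m01 m10 m11 cn0.
  split => [H|H].
    by apply: (mulfI cn0); lra.
  have := congr1 ( *%R (m00 * m11 - m01 * m10)) H; lra.
by move=> s t; rewrite !in_itv/= => sab tab /(par s sab) H; apply/(par t tab).
Qed.

Lemma angle_lift_polar x xi v : xi != 0 -> angle_lift f I x xi v ->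
  forall t, 0 <= t -> polar ((differential (ext t) x *m xi) 0 0)
    ((differential (ext t) x *m xi) 1 0) (v t).
Proof.
move=> xi0 [_ vE] t t0; apply/polar_angle; last exact: vE.
have [_ u] := extend_isotopy_differential x t0.
apply: contra_neq xi0 => H.
by rewrite -[xi](mulKmx u) H mulmx0.
Qed.

Lemma chi_neq0 : chi R != 0.
Proof. by rewrite col_neq0 !mxE/= oner_neq0 orbT. Qed.

Section Negative.
Hypothesis chi_neg : forall x, exists2 c, angle_lift f I x (chi R) c & c 1 < c 0.

(** Comparison with the vertical vector at the [k]-th iterate. Its initial angle [c 0] is an
    integer, so [j - 2 * c 0] is an admissible barrier, and [c 1 < c 0] makes the final inequality
    strict. *)
Lemma negative_torsion_step x xi (v : R -> R) (k : nat) (j : R) :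
  {within `[k%:R, k%:R + 1], continuous v} ->
  (forall t, k%:R <= t <= k%:R + 1 -> polar ((differential (ext t) x *m xi) 0 0)
    ((differential (ext t) x *m xi) 1 0) (v t)) ->
  j \is a Num.int -> 2 * v k%:R <= j -> 2 * v (k%:R + 1) < j.
Proof.
move=> vc vP jZ vk.
have [c cL c10] := chi_neg (iter k f x).
have cP := angle_lift_polar chi_neq0 cL.
have c0Z : c 0 \is a Num.int.
  have := cP 0 (lexx _); rewrite differential_extend_isotopy0 mul1mx !mxE/= => h.
  have base : polar 0 1 (0 : R).
    by exists 1 => //; rewrite mulr0 sin0 cos0 mulr0 mulr1.
  by have := polar_unique h base; rewrite subr0.
have tk (t : R) : 0 <= t <= 1 -> k%:R <= k%:R + t <= k%:R + 1 by lra.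
have jcZ : j - 2 * c 0 \is a Num.int.
  by apply: rpredB => //; apply: rpredM => //; exact: natr_int.
have := @polar_barrier (fun t => differential (ext t) (iter k f x))
  (differential (ext k%:R) x *m xi) (chi R) (fun t => v (k%:R + t)) c 0 1
  (j - 2 * c 0) ler01 jcZ.
rewrite addr0 => /(_ _ _ _ _ _ _) H.
have : 2 * (v (k%:R + 1) - c 1) <= j - 2 * c 0.
  apply: H.
  - by move=> t /andP[t0 _]; case: (extend_isotopy_differential (iter k f x) t0).
  - apply: (within_comp (phi := fun t => k%:R + t)) vc _ _ => [t|t].
      by apply: (@cvgD _ _ _ (nbhs t)); [exact: cvg_cst|exact: cvg_id].
    by rewrite /= !in_itv/=; exact: tk.
  - apply: (continuous_subspaceW _ cL.1) => t /=; rewrite !in_itv/= andbT.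
    by case/andP.
  - move=> t t01; have t0 := (andP t01).1.
    by rewrite mulmxA -extend_isotopy_differentialD//; apply: vP; exact: tk.
  - by move=> t /andP[t0 _]; exact: cP.
  - lra.
lra.
Qed.

End Negative.
End Torsion.

(** * A point of zero torsion on each horizontal circle *)

Section ZeroTorsion.
Variable R : realType.

(** The lift is continuous in the base point as well, so that bounds pass to limits of points;
    subtracting the integer [L (0, 0) + 1/4] normalizes it. *)
Lemma horizontal_lift (f : annulus R -> annulus R) (I : R -> annulus R -> annulus R)
    (n : nat) (r : R) : isotopy f I ->
  exists2 L : R * R -> R, continuous L &
    (forall s, 0 <= s <= 1 -> L (0, s) = - 4^-1) /\
    (forall t s, 0 <= t <= n%:R -> 0 <= s <= 1 ->
      polar (differential (extend_isotopy f I t) (circle_pi s, r) 0 0)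
        (differential (extend_isotopy f I t) (circle_pi s, r) 1 0) (L (t, s))).
Proof.
move=> hI.
have [H [HC Hn _]] := extend_isotopy_family n hI.
pose V i (p : R * R) := differential (H p.1) (circle_pi p.2, r) i 0.
have V_c i : continuous (V i).
  move=> p; apply: (@continuous_comp _ _ _ (fun p : R * R => (p.1, (circle_pi p.2, r)))
    (fun p : R * annulus R => differential (H p.1) p.2 i 0)).
    apply: (@continuous_pair _ _ _ fst (fun p : R * R => (circle_pi p.2, r))).
      exact: fst_continuous.
    apply: (@continuous_pair _ _ _ (fun p : R * R => circle_pi p.2) (fun p : R * R => r)).
      apply: (@continuous_comp _ _ _ snd (@circle_pi R)); first exact: snd_continuous.
      exact: circle_pi_continuous.
    exact: cvg_cst.
  exact: (family_differential_continuous HC).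
have V0 p : (V 0 p != 0) || (V 1 p != 0).
  have := unitmx2_neq0 (family_unitmx HC p.1 (circle_pi p.2, r)); apply: contraTT.
  rewrite negb_or !negbK /V => /andP[/eqP -> /eqP ->].
  by rewrite mul0r mulr0 subr0.
have [L Lc LV] := polar_lift (ler0n R n) ler01 (fun p _ => V_c 0 p)
  (fun p _ => V_c 1 p) (fun p _ => V0 p).
have LP t s : 0 <= t <= n%:R -> 0 <= s <= 1 ->
      polar (differential (extend_isotopy f I t) (circle_pi s, r) 0 0)
        (differential (extend_isotopy f I t) (circle_pi s, r) 1 0) (L (t, s)).
  move=> tn s01; rewrite -(Hn t tn); apply: (LV (t, s)).
  by split; rewrite /= ger0_norm; move: tn s01; do 2 case/andP => ? ?.
have L0Z s : 0 <= s <= 1 -> L (0, s) + 4^-1 \is a Num.int.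
  move=> s01; have := LP 0 s; rewrite lexx ler0n => /(_ isT s01).
  by rewrite (differential_extend_isotopy0 hI) !mxE/= => /polar_right.
have I0 : 0 <= (0 : R) <= 1 by rewrite ?lexx ?ler01.
have L0c s : 0 <= s <= 1 -> L (0, s) = L (0, 0).
  move=> s01; apply: (@addIr R (4^-1)).
  apply: (int_valued_constant_itv (a := 0) (b := 1)
    (d := fun d => L (0, d) + 4^-1)) => // d.
  apply: (@cvgD _ _ _ (nbhs d)); last exact: cvg_cst.
  apply: (@continuous_comp _ _ _ (fun d => (0, d)) L); last exact: Lc.
  by apply: (@continuous_pair _ _ _ (cst 0) id); [exact: cvg_cst|exact: cvg_id].
exists (fun p => L p - (L (0, 0) + 4^-1)).
  by move=> p; apply: (@cvgB _ _ _ (nbhs p)); [exact: Lc|exact: cvg_cst].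
split => [s s01|t s tn s01]; first by rewrite L0c//; lra.
by apply: polarDz; [rewrite rpredN; exact: L0Z|exact: LP].
Qed.

Lemma zero_torsion_horizontal (f : annulus R -> annulus R) (r : R) :
  negative_torsion_map f -> exists s : R, has_torsion f (circle_pi s, r) 0.
Proof.
move=> [_ fI fneg].
set I := chosen_isotopy f.
have hI : isotopy f I by apply: xgetPex.
pose gam (s : R) : annulus R := (circle_pi s, r).
have liftP x xi : (exists v, angle_lift f I x xi v) ->
    angle_lift f I x xi (chosen_lift f x xi) by move=> h; apply: xgetPex.
have liftN x xi : ~ (exists v, angle_lift f I x xi v) -> chosen_lift f x xi = fun=> 0.
  by move=> h; apply: xgetPN => v hv; apply: h; exists v.
(* Without a lift, the default constant one would give torsion 0 and contradict negativity. *)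
have chi_neg x : exists2 c, angle_lift f I x (chi R) c & c 1 < c 0.
  exists (chosen_lift f x (chi R)).
    apply: liftP; apply: contrapT => /liftN h.
    by have := fneg x; rewrite /torsion_n h subrr mul0r ltxx.
  by have := fneg x; rewrite /torsion_n divr1 subr_lt0.
(* There is one lift for each time range [[0, n]]; the common initial value -1/4 makes them
   compatible, as [Lmn] shows. *)
have /boolp.choice[L LP] : forall n, exists g : R * R -> R,
    [/\ continuous g, forall s, 0 <= s <= 1 -> g (0, s) = - 4^-1 &
     forall t s, 0 <= t <= n%:R -> 0 <= s <= 1 ->
      polar (differential (extend_isotopy f I t) (gam s) 0 0)
        (differential (extend_isotopy f I t) (gam s) 1 0) (g (t, s))].
  move=> n; have [L Lc [L0 LP]] := horizontal_lift n r hI.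
  by exists L.
pose e1 : 'cV[R]_2 := delta_mx 0 0.
have e1E (M : 'M[R]_2) i : (M *m e1) i 0 = M i 0 by rewrite -colE mxE.
have Lt_c n s : continuous (fun t => L n (t, s)).
  have [Lc _ _] := LP n.
  move=> t; apply: (@continuous_comp _ _ _ (fun t => (t, s)) (L n)); last exact: Lc.
  by apply: (@continuous_pair _ _ _ id (cst s)); [exact: cvg_id|exact: cvg_cst].
have Ls_c n t : continuous (fun s => L n (t, s)).
  have [Lc _ _] := LP n.
  move=> s; apply: (@continuous_comp _ _ _ (fun s => (t, s)) (L n)); last exact: Lc.
  by apply: (@continuous_pair _ _ _ (cst t) id); [exact: cvg_cst|exact: cvg_id].
have Lmn m n t s : (m <= n)%N -> 0 <= t <= m%:R -> 0 <= s <= 1 ->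
    L n (t, s) = L m (t, s).
  move=> mn tm s01.
  have [_ L0n LPn] := LP n; have [_ L0m LPm] := LP m.
  suff : L n (t, s) - L m (t, s) = L n (0, s) - L m (0, s).
    by rewrite L0n// L0m//; lra.
  apply: (int_valued_constant_itv (a := 0) (b := m%:R)
    (d := fun t => L n (t, s) - L m (t, s))) => //.
  - by move=> t'; apply: (@cvgB _ _ _ (nbhs t')); exact: Lt_c.
  - move=> t' /andP[t'0 t'm].
    apply: polar_unique (LPn t' s _ s01) (LPm t' s _ s01); rewrite t'0//=.
    by apply: le_trans t'm _; rewrite ler_nat.
  - by rewrite lexx ler0n.
have step n k s j : (k < n)%N -> 0 <= s <= 1 -> j \is a Num.int ->
    2 * L n (k%:R, s) <= j -> 2 * L n (k.+1%:R, s) < j.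
  move=> kn s01 jZ; rewrite -[k.+1%:R]natr1.
  apply: (negative_torsion_step hI chi_neg (x := gam s) (xi := e1)
    (v := fun t => L n (t, s))) => //.
    by apply: continuous_subspaceT; exact: Lt_c.
  have [_ _ LPn] := LP n.
  move=> t /andP[kt tk]; rewrite !e1E; apply: LPn => //.
  rewrite (le_trans _ kt)//=; apply: le_trans tk _.
  by rewrite natr1 ler_nat.
have descend n k i s j : (k + i <= n)%N -> 0 <= s <= 1 -> j \is a Num.int ->
    2 * L n (k%:R, s) <= j -> 2 * L n ((k + i)%:R, s) <= j.
  elim: i => [|i IH]; first by rewrite addn0.
  rewrite addnS => kin s01 jZ kj; apply/ltW/step => //.
  by apply: IH => //; exact: ltnW.
have /boolp.choice[sq sqP] : forall n, exists s, 0 <= s <= 1 /\ - 4^-1 <= L n (n%:R, s).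
  move=> n; have [H [HC Hn _]] := extend_isotopy_family n hI.
  have H0 : H 0 = id by rewrite Hn ?lexx ?ler0n// (extend_isotopy_nat hI 0).
  have [s s01 sP] := lowest_point_angle r HC H0 (ler0n R n).
  have [_ L0 LPn] := LP n.
  exists s; split => //; apply: (sP (fun t => L n (t, s))).
  - by apply: continuous_subspaceT; exact: Lt_c.
  - by move=> t tn; rewrite Hn//; exact: LPn.
  - exact: L0.
have sq_lower m n : (m <= n)%N -> - 2^-1 <= L m (m%:R, sq n).
  move=> mn; have [s01 Ln] := sqP n.
  rewrite -(Lmn m n) ?lexx ?ler0n//= leNgt; apply/negP => Lm.
  have := @descend n m (n - m)%N (sq n) (- 1).
  rewrite subnKC// leqnn s01 rpredN int_num1 => /(_ isT isT isT) H.
  have : 2 * L n (n%:R, sq n) <= - 1 by apply: H; lra.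
  by lra.
have [s [s01 s_cl]] : exists s, 0 <= s <= 1 /\ cluster (sq n @[n --> \oo]) s.
  have [|s [/= sI scl]] := @segment_compact R 0 1 (sq n @[n --> \oo]) _.
    by exists 0%N => // n _; rewrite /= in_itv/=; case: (sqP n).
  by exists s; split => //; move: sI; rewrite in_itv.
(* For fixed [m] the bound holds at [sq n] for all [n >= m], and it is a closed condition on the
   point. *)
have s_lower m : - 2^-1 <= L m (m%:R, s).
  rewrite leNgt; apply/negP => Lm.
  have A1 : (sq n @[n --> \oo]) [set s | - 2^-1 <= L m (m%:R, s)].
    by exists m => // n /= mn; apply: sq_lower.
  have A2 : nbhs s [set s | L m (m%:R, s) < - 2^-1].
    exact: (cvgr_lt _ (Ls_c m m%:R s)).
  have [s' [/= h1 h2]] := s_cl _ _ A1 A2.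
  by have := le_lt_trans h1 h2; rewrite ltxx.
have s_upper m : L m (m%:R, s) <= 0.
  have [_ L0 _] := LP m.
  have := @descend m 0 m s 0; rewrite add0n leqnn L0// s01 int_num0.
  by move=> /(_ isT isT isT); lra.
exists s => xi xi0.
(* If there were no lift for [xi], the chosen one would be constant and the limit trivial. *)
have [/liftP vP|/liftN vN] := pselect (exists v, angle_lift f I (gam s) xi v);
  last first.
  by rewrite /torsion_n vN; under eq_fun do rewrite subrr mul0r; exact: cvg_cst.
set v := chosen_lift f (gam s) xi in vP.
have vL := angle_lift_polar hI xi0 vP.
(* Barriers at the ceilings of the initial values, in both directions, let the angle from the
   horizontal vector to [xi] drift by less than 1/2; [L] itself goes from -1/4 into [[-1/2, 0]]. *)
have v_bound n : `|v n%:R - v 0| <= 1.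
  have [_ L0 LPn] := LP n.
  have vc : {within `[0, n%:R], continuous v}.
    apply: (continuous_subspaceW _ vP.1) => t /=; rewrite !in_itv/= andbT.
    by case/andP.
  have wc : {within `[0, n%:R], continuous (fun t => L n (t, s))}.
    by apply: continuous_subspaceT; exact: Lt_c.
  have vPn t : 0 <= t <= n%:R -> polar
      ((differential (extend_isotopy f I t) (gam s) *m xi) 0 0)
      ((differential (extend_isotopy f I t) (gam s) *m xi) 1 0) (v t).
    by move=> /andP[t0 _]; exact: vL.
  have wPn t : 0 <= t <= n%:R -> polar
      ((differential (extend_isotopy f I t) (gam s) *m e1) 0 0)
      ((differential (extend_isotopy f I t) (gam s) *m e1) 1 0) (L n (t, s)).
    by move=> tn; rewrite !e1E; exact: LPn.
  have Mu t : 0 <= t <= n%:R ->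
      differential (extend_isotopy f I t) (gam s) \in unitmx.
    by move=> /andP[t0 _]; case: (extend_isotopy_differential hI (gam s) t0).
  have ceilZ (x : R) : (Num.ceil x)%:~R \is a @Num.int R by exact: intr_int.
  have u1 := polar_barrier (ler0n R n) (ceilZ _) Mu vc wc vPn wPn (ceil_ge _).
  have u2 := polar_barrier (ler0n R n) (ceilZ _) Mu wc vc wPn vPn (ceil_ge _).
  have c1 := ceilB1_lt (2 * (v 0 - L n (0, s))).
  have c2 := ceilB1_lt (2 * (L n (0, s) - v 0)).
  rewrite intrB in c1 c2.
  have := s_lower n; have := s_upper n; have := L0 s s01.
  by rewrite ler_norml; lra.
have hc : (fun n => 2 * n.+1%:R^-1 : R) @ \oo --> (0 : R).
  rewrite -[X in _ --> X](mulr0 2); apply: cvgM; first exact: cvg_cst.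
  exact: cvg_harmonic.
(* The shifted bound is the harmonic sequence up to a factor; it also covers [n = 0], where division
   by zero gives 0. *)
have tb n : `|torsion_n n f (gam s) xi| <= 2 * n.+1%:R^-1.
  case: n => [|n]; first by rewrite /torsion_n invr0 mulr0 normr0.
  rewrite /torsion_n normrM normfV (ger0_norm (ler0n R n.+1)) ler_pdivrMr ?ltr0n//.
  apply: le_trans (v_bound _) _.
  rewrite mulrAC ler_pdivlMr ?ltr0n// mul1r -[2 * _]/(2%:R * n.+1%:R) -natrM ler_nat.
  by rewrite mul2n -addnn addSnnS addnS ltnS leq_addl.
apply/norm_cvg0P.
apply: (squeeze_cvgr _ (cvg_cst 0) hc).
by near=> n; rewrite normr_ge0 tb.
Unshelve. all: by end_near. Qed.
End ZeroTorsion.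

(** * Hausdorff dimension *)

Section Hausdorff.
Variable R : realType.

Lemma height_dist (x y : annulus R) : `|y.2 - x.2| <= annulus_dist x y.
Proof.
apply: lb_le_inf.
  have [h hE] := cover_surj (y - x).
  by exists (enorm h), h => //=; rewrite hE addrC subrK.
move=> _ [h /= -> <-].
rewrite /= addrC addKr -sqrtr_sqr; apply: ler_wsqrtr.
by rewrite lerDr sqr_ge0.
Qed.

(** Heights of points of [U] differ by at most its diameter [l]; as [l] and [s] are at most 1, [l]
    is bounded by its power of exponent [s]. *)
Lemma height_interval (U : set (annulus R)) (s : R) : 0 <= s <= 1 ->
  (diam (@annulus_dist R) U <= 1%:E)%E ->
  exists J : interval R, [/\ (snd @` U `<=` [set` J]) &
    (lebesgue_measure [set` J] <= diam_pow (@annulus_dist R) s U)%E].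
Proof.
move=> /andP[s0 s1] dU; rewrite /diam_pow; case: ifP => [/eqP ->|/negbT/set0P[u Uu]].
  exists `]0, 0[; rewrite image_set0 set_itv_ge ?bnd_simp ?ltxx//.
  by split; rewrite ?measure0.
have d0 : (0 <= diam (@annulus_dist R) U)%E.
  by apply: ereal_sup_ubound; left.
have dfin : diam (@annulus_dist R) U \is a fin_num.
  by rewrite ge0_fin_numE//; apply: le_lt_trans dU _; exact: ltry.
pose l := fine (diam (@annulus_dist R) U).
have lE : diam (@annulus_dist R) U = l%:E by rewrite fineK.
have l0 : 0 <= l by rewrite -lee_fin -lE.
have l1 : l <= 1 by rewrite -lee_fin -lE.
have close x y : U x -> U y -> y.2 <= x.2 + l.
  move=> Ux Uy; have : ((annulus_dist x y)%:E <= l%:E)%E.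
    by rewrite -lE; apply: ereal_sup_ubound; right; exists x => //; exists y.
  rewrite lee_fin => h; have := height_dist x y; rewrite ler_norml; lra.
pose a := inf (snd @` U).
have lbU : has_lbound (snd @` U).
  by exists (u.2 - l) => _ [x Ux <-]; have := close x u Ux Uu; lra.
exists `[a, a + l]; split.
  move=> _ [x Ux <-]; rewrite /= in_itv/=; apply/andP; split.
    by apply: inf_lbound => //; exists x.
  rewrite -lerBlDr; apply: lb_le_inf; first by exists u.2, u.
  by move=> _ [y Uy <-]; have := close y x Uy Ux; lra.
rewrite lebesgue_measure_itv/= lte_fin lE.
have -> : (l%:E `^ s = (l `^ s)%:E)%E by [].
case: ifP => [al|_]; last by rewrite lee_fin powR_ge0.
rewrite -EFinD lee_fin addrC addKr.
have lpos : 0 < l by rewrite ltrDl in al.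
by rewrite -{1}(powRr1 l0); apply: ger_powR => //; rewrite lpos.
Qed.

(** For [s < 1], scale 1 is already enough: the heights of the pieces of a cover fill [[0, 1]], so
    subadditivity of the Lebesgue measure bounds the content below by 1. *)
Lemma hausdorff_dim_ge1 (E : set (annulus R)) :
  (forall r : R, exists c, E (c, r)) ->
  (1 <= hausdorff_dim (@annulus_dist R) E)%E.
Proof.
move=> Er; apply: le_ereal_inf_tmp => _ [s [s0 Es] <-].
rewrite lee_fin leNgt; apply/negP => s1.
suff : (1 <= hausdorff_measure (@annulus_dist R) s E)%E.
  by rewrite Es leNgt lte01.
apply: (@le_trans _ _ (hausdorff_content (@annulus_dist R) s 1 E)); last first.
  by apply: ereal_sup_ubound; exists 1 => //=; exact: ltr01.
apply: le_ereal_inf_tmp => _ [U [EU dU] <-].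
have /boolp.choice[J JP] : forall k, exists J : interval R,
    (snd @` U k `<=` [set` J]) /\
    (lebesgue_measure [set` J] <= diam_pow (@annulus_dist R) s (U k))%E.
  move=> k; have [|J [J1 J2]] := @height_interval (U k) s _ (dU k).
    by rewrite s0 ltW.
  by exists J.
apply: (@le_trans _ _ (\sum_(0 <= k <oo) lebesgue_measure [set` J k])%E).
  have -> : 1%E = lebesgue_measure (`[0, 1]%classic : set R).
    by rewrite lebesgue_measure_itv/= lte_fin ltr01 sube0.
  apply: measure_sigma_subadditive => //.
    by move=> r _; have [c Ec] := Er r; have [k _ Uk] := EU _ Ec;
      exists k => //; apply: (JP k).1; exists (c, r).
by apply: lee_nneseries => k *; [exact: measure_ge0|exact: (JP k).2].
Qed.

End Hausdorff.

Theorem corollary1p1 (R : realType) (f : annulus R -> annulus R)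
  (hf : negative_torsion_map f) :
  (1 <= hausdorff_dim (@annulus_dist R)
          [set z : annulus R | has_torsion f z 0])%E.
Proof.
apply: hausdorff_dim_ge1 => r.
by have [s sP] := zero_torsion_horizontal r hf; exists (circle_pi s).
Qed.
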